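(* Let $(X,T)$ be a $\mathbb{Z}^2$-topological dynamical system, $\mu\in M(X,T)$ a $T$-invariant Borel probability measure, and $\vec v=(1,\beta)\in\mathbb{R}^2$ a direction vector with $\beta$ irrational. Let $(\widetilde X,\widetilde{\mathcal B},\widetilde\mu,\Theta)$ be the associated skew product system, with cocycle $\varphi$. Then $$h_\mu^{\vec v}(T)=h_{\widetilde\mu}(\Theta)=h_{\widetilde\mu}(\varphi),$$ where $h_\mu^{\vec v}(T)$ is the directional measure-theoretic entropy of $\mu$ along $\vec v$, $h_{\widetilde\mu}(\Theta)$ is the measure-theoretic entropy of the skew product, and $h_{\widetilde\mu}(\varphi)$ is the fiber entropy of $\varphi$.
   Context: A $\mathbb{Z}^2$-topological dynamical system $(X,T)$ is a compact metric space $(X,d)$ with homeomorphisms $T^{\vec w}$, $\vec w\in\mathbb{Z}^2$, such that $T^{\vec w}\circ T^{\vec u}=T^{\vec w+\vec u}$ and $T^{\vec 0}=\mathrm{id}$. $\mathcal{B}_X$ is the Borel $\sigma$-algebra; $M(X,T)$ is the set of Borel probability measures $\mu$ with $\mu(T^{-\vec w}B)=\mu(B)$ for all $\vec w\in\mathbb{Z}^2$, $B\in\mathcal{B}_X$. $\mathcal{P}_X$ is the set of finite Borel partitions of $X$, and $H_\mu(\alpha)=-\sum_{A\in\alpha}\mu(A)\log\mu(A)$. Directional entropy: for $b>0$ let $\Lambda^{\vec v}(b)=\{(m,n)\in\mathbb{Z}^2:\beta m-b\le n\le\beta m+b\}$ and $\Lambda_N^{\vec v}(b)=\Lambda^{\vec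 v}(b)\cap([0,N-1]\times\mathbb{Z})$. For $\alpha\in\mathcal{P}_X$, $$h_\mu^{\vec v}(T,\alpha)=\sup_{b>0}\limsup_{N\to\infty}\frac1N H_\mu\Big(\bigvee_{(m,n)\in\Lambda_N^{\vec v}(b)}T^{-(m,n)}\alpha\Big),\qquad h_\mu^{\vec v}(T)=\sup_{\alpha\in\mathcal{P}_X}h_\mu^{\vec v}(T,\alpha).$$ Skew product: $\Omega=[0,1)$ is the one-dimensional torus with Borel $\sigma$-algebra $\mathcal{C}$ and Lebesgue measure $m$; $R_\beta t=t+\beta\pmod 1$. Put $\widetilde X=\Omega\times X$, $\widetilde{\mathcal B}=\mathcal{C}\times\mathcal{B}_X$ (product $\sigma$-algebra), $\widetilde\mu=m\times\mu$, and $$\Theta(t,x)=(R_\beta t,\varphi(1,t)x),\qquad \varphi(1,t)=T^{(1,[\beta+t])},$$ where $[a]$ is the largest integer $\le a$. Write $\varphi(0,t)=\mathrm{id}$ and $\varphi(i,t)=\varphi(1,R_\beta^{i-1}t)\circ\cdots\circ\varphi(1,t)$ for $i\ge1$. $h_{\widetilde\mu}(\Theta)$ is the usual Kolmogorov–Sinai entropy of the measure preserving transformation $\Theta$. The fiber entropy is $h_{\widetilde\mu}(\varphi)=\sup_{\alpha\in\mathcal{P}_X}h_{\widetilde\mu}(\varphi,\alpha)$, where $$h_{\widetilde\mu}(\varphi,\alpha)=\lim_{n\to\infty}\int_\Omega\frac1n H_\mu\Big(\bigvee_{i=0}^{n-1}\varphi(i,t)^{-1}\alpha\Big)\,dm(t).$$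 *)

(* Defs.v *)
From HB Require Import structures.
From mathcomp Require Import all_boot all_order all_algebra.
From mathcomp Require Import all_classical all_reals all_analysis.

Set Implicit Arguments.
Unset Strict Implicit.
Unset Printing Implicit Defensive.

Import Order.TTheory GRing.Theory Num.Theory.
Import numFieldNormedType.Exports.

Local Open Scope classical_set_scope.
Local Open Scope ring_scope.

(* The library's measurable types are pointed, so X must be too; this only
   excludes the empty space, which carries no probability measure. *)
#[short(type="pmetricType")]
HB.structure Definition PMetric (K : numDomainType) :=
  { M of Metric K M & isPointed M }.

Notation borel X := (g_sigma_algebraType (@open X)).

Definition finite_partition d (T : measurableType d) (a : set (set T)) : Prop :=
  [/\ finite_set a, a `<=` measurable & partition a id [set: T]].

Definition preimage_partition (S T : Type) (f : S -> T) (a : set (set T)) :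
  set (set S) := [set f @^-1` A | A in a].

(* The members of the join are the nonempty intersections: the empty sets that
   preimage_partition may create are discarded here. *)
Definition partition_join (I T : Type) (J : set I) (a : I -> set (set T)) :
    set (set T) :=
  [set B | B !=set0 /\ exists2 A : I -> set T,
     (forall i, J i -> a i (A i)) & B = \bigcap_(i in J) A i].

(* Terms with mu A = 0 vanish, which is the convention 0 log 0 = 0. *)
Definition entropy d (T : measurableType d) (R : realType)
    (mu : probability T R) (a : set (set T)) : R :=
  - \sum_(A \in a) (fine (mu A) * ln (fine (mu A))).

Section ks_entropy.
Context d (T : measurableType d) (R : realType).
Variables (mu : probability T R) (f : T -> T).

Definition ks_entropy_part (a : set (set T)) : \bar R :=
  limn (fun n => (n%:R^-1 *
    entropy mu (partition_join `I_n
      (fun i => preimage_partition (iter i f) a)))%:E).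

Definition ks_entropy : \bar R :=
  ereal_sup [set ks_entropy_part a | a in @finite_partition d T].

End ks_entropy.

Definition homeomorphism (X Y : topologicalType) (f : X -> Y) : Prop :=
  continuous f /\ exists g : Y -> X, [/\ continuous g, cancel f g & cancel g f].

Definition Z2_action (X : topologicalType) (T : int * int -> X -> X) : Prop :=
  [/\ forall w, homeomorphism (T w),
      forall w u, T w \o T u = T (w + u) & T 0 = id].

Definition Z2_invariant (R : realType) (X : pmetricType R)
    (T : int * int -> X -> X) (mu : probability (borel X) R) : Prop :=
  forall w (B : set (borel X)), measurable B -> mu (T w @^-1` B) = mu B.

Section directional_entropy.
Context (R : realType) (X : pmetricType R).
Variables (T : int * int -> X -> X) (mu : probability (borel X) R) (beta : R).

Definition strip (b : R) : set (int * int) :=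
  [set w | beta * w.1%:~R - b <= w.2%:~R <= beta * w.1%:~R + b].

Definition strip_upto (b : R) (N : nat) : set (int * int) :=
  strip b `&` [set w | 0 <= w.1 <= N%:Z - 1].

Definition dir_entropy_part (a : set (set (borel X))) : \bar R :=
  ereal_sup [set limn_esup (fun N => (N%:R^-1 *
      entropy mu (partition_join (strip_upto b N)
        (fun w => preimage_partition (T w : borel X -> borel X) a)))%:E)
    | b in [set b : R | 0 < b]].

Definition dir_entropy : \bar R :=
  ereal_sup [set dir_entropy_part a | a in @finite_partition _ (borel X)].

End directional_entropy.

Definition torus (R : realType) := {t : R | 0 <= t < 1}.

Section torus.
Context (R : realType).

HB.instance Definition _ := Choice.on (torus R).

Lemma torus0_subproof : 0 <= (0 : R) < 1.
Proof. by rewrite lexx ltr01. Qed.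

HB.instance Definition _ :=
  isPointed.Build (torus R) (exist _ 0 torus0_subproof).

Definition torus_val : torus R -> R := sval.

Definition torus_measurable : set (set (torus R)) :=
  preimage_set_system setT torus_val measurable.

Lemma torus_measurable0 : torus_measurable set0.
Proof. by exists set0 => //; rewrite preimage_set0 setI0. Qed.

Lemma torus_measurableC A : torus_measurable A -> torus_measurable (~` A).
Proof.
by move=> [B mB <-]; exists (~` B); [exact: measurableC|rewrite !setTI].
Qed.

Lemma torus_measurable_bigcup (F : (set (torus R))^nat) :
  (forall i, torus_measurable (F i)) -> torus_measurable (\bigcup_i F i).
Proof.
move=> mF; pose G i := projT1 (cid2 (mF i)).
exists (\bigcup_i G i); first by
  apply: bigcupT_measurable => i; rewrite /G; case: cid2.
rewrite setTI preimage_bigcup; apply: eq_bigcupr => i _.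
by rewrite /G; case: cid2 => B mB /= <-; rewrite setTI.
Qed.

HB.instance Definition _ := @isMeasurable.Build default_measure_display
  (torus R) torus_measurable torus_measurable0 torus_measurableC
  torus_measurable_bigcup.

Definition torus_leb (A : set (torus R)) : \bar R :=
  lebesgue_measure (torus_val @` A).

Lemma torus_val_inj : injective torus_val.
Proof. exact: val_inj. Qed.

Lemma measurable_torus_image (A : set (torus R)) :
  measurable A -> measurable (torus_val @` A).
Proof.
move=> [B mB <-]; rewrite setTI.
have -> : torus_val @` (torus_val @^-1` B) = B `&` `[0, 1[%classic.
  apply/seteqP; split => [_ [[t t01] Bt <-]|t [Bt]].
    by split => //=; rewrite in_itv.
  by rewrite /= in_itv => t01; exists (exist _ t t01).
exact: measurableI.
Qed.

Let torus_leb0 : torus_leb set0 = 0%E.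
Proof. by rewrite /torus_leb image_set0 measure0. Qed.

Let torus_leb_ge0 A : (0 <= torus_leb A)%E.
Proof. exact: measure_ge0. Qed.

Let torus_leb_sigma_additive : semi_sigma_additive torus_leb.
Proof.
move=> F mF tF mUF; rewrite /torus_leb image_bigcup.
apply: measure_semi_sigma_additive.
- by move=> i; exact: measurable_torus_image.
- move=> i j _ _ [_ [[x Fx <-] [y Fy /torus_val_inj yx]]].
  by apply: tF => //; exists x; split => //; rewrite -yx.
- by rewrite -image_bigcup; exact: measurable_torus_image.
Qed.

HB.instance Definition _ := isMeasure.Build _ _ _ torus_leb
  torus_leb0 torus_leb_ge0 torus_leb_sigma_additive.

Let torus_lebT : torus_leb setT = 1%E.
Proof.
rewrite /torus_leb.
have -> : torus_val @` setT = `[0, 1[%classic.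
  apply/seteqP; split => [_ [[t t01] _ <-]|t] /=; rewrite in_itv//=.
  by move=> t01; exists (exist _ t t01).
by rewrite lebesgue_measure_itv/= lte_fin ltr01 sube0.
Qed.

HB.instance Definition _ :=
  Measure_isProbability.Build _ _ _ torus_leb torus_lebT.

Lemma rot_subproof (beta : R) (t : torus R) :
  0 <= torus_val t + beta - (Num.floor (torus_val t + beta))%:~R < 1.
Proof. have /andP[le_f lt_f] := floor_itv (torus_val t + beta).
by rewrite subr_ge0 le_f/= ltrBlDl -intrD1.
Qed.

Definition rot (beta : R) (t : torus R) : torus R :=
  exist (fun u : R => 0 <= u < 1) _ (rot_subproof beta t).

End torus.

Section skew_product.
Context (R : realType) (X : pmetricType R).
Variables (T : int * int -> X -> X) (mu : probability (borel X) R) (beta : R).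

Definition cocycle1 (t : torus R) : borel X -> borel X :=
  T (1, Num.floor (beta + torus_val t)).

Fixpoint cocycle (i : nat) (t : torus R) : borel X -> borel X :=
  if i is j.+1 then cocycle1 (iter j (rot beta) t) \o cocycle j t else id.

Definition skew_product (p : torus R * borel X) : torus R * borel X :=
  (rot beta p.1, cocycle1 p.1 p.2).

Definition skew_measure : probability (torus R * borel X)%type R :=
  (@torus_leb R \x mu)%E.

Definition fiber_entropy_part (a : set (set (borel X))) : \bar R :=
  limn (fun n => \int[@torus_leb R]_t (n%:R^-1 *
    entropy mu (partition_join `I_n
      (fun i => preimage_partition (cocycle i t) a)))%:E)%E.

Definition fiber_entropy : \bar R :=
  ereal_sup [set fiber_entropy_part a | a in @finite_partition _ (borel X)].

End skew_product.

(* Main.v *)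
(** The chain [fiber <= Kolmogorov-Sinai <= directional <= fiber].

    The cocycle is [phi(i, t) = T^(i, [i beta + t])], so the lattice points
    visited up to time [n] stay in the strip of half-width 1, and conversely
    the strip of half-width [b] is covered by the vertical translates by
    [|k| <= K] of that path, for [K > b + 1]. Hence the entropy of a partition
    over the strip is at most the fiber entropy of its join with its vertical
    translates. The first inequality is concavity of [- x ln x].
    For the second one, atoms of a partition of the product are approximated
    by finite unions [D_j] of rectangles (interval times Borel set). The atom is
    recovered from [D_j] and the small error set [E_j], so subadditivity
    bounds the n-th join of the partition by the entropy of an interval
    partition of the circle with O(n) pieces, which is O(ln n), plus the
    entropy over the strip of half-width 1, plus [n * sum_j H(E_j)]. *)

From mathcomp Require Import all_boot all_order all_algebra.
From mathcomp Require Import all_classical all_reals all_analysis.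
From mathcomp Require Import measurable_realfun.
From mathcomp Require Import ring lra zify.
Require Import Defs.

Set Implicit Arguments.
Unset Strict Implicit.
Unset Printing Implicit Defensive.

Import Order.TTheory GRing.Theory Num.Theory.
Import numFieldNormedType.Exports.

Local Open Scope classical_set_scope.
Local Open Scope ring_scope.

(** * Entropy of label maps *)

(** The summand of Shannon entropy. At [0] the product vanishes, in accordance with the convention
    [0 log 0 = 0]. *)
Definition eta {R : realType} (x : R) : R := - (x * ln x).

Lemma eta_ge0 (R : realType) (x : R) : 0 <= x <= 1 -> 0 <= eta x.
Proof.
move=> /andP[x0 x1]; rewrite /eta -mulrN mulr_ge0// oppr_ge0.
exact: ln_le0.
Qed.

(** This is [ln y <= y - 1] at [y = q / p], multiplied by [p]. Subadditivity, the bound by [ln #|L|]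
    and concavity all come from suitable choices of [q], for which the terms [q - p] cancel in the
    sum. *)
Lemma eta_gibbs (R : realType) (p q : R) : 0 <= p -> 0 <= q ->
  (q = 0 -> p = 0) -> eta p <= - (p * ln q) + q - p.
Proof.
move=> p0 q0 qp; rewrite /eta.
have [->|p_neq0] := eqVneq p 0; first by rewrite !mul0r; lra.
have {}p0 : 0 < p by rewrite lt_def p_neq0.
have {qp}q0 : 0 < q.
  by rewrite lt_def q0 andbT; apply/eqP => /qp/eqP; rewrite (negbTE p_neq0).
have : ln (1 + (q / p - 1)) <= q / p - 1.
  by apply: le_ln1Dx; have := divr_gt0 q0 p0; lra.
rewrite addrC subrK ln_div ?posrE// => h.
have : p * (ln q - ln p) <= p * (q / p - 1) by rewrite ler_pM2l.
rewrite !mulrBr mulrCA divff ?gt_eqF// mulr1; lra.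
Qed.

Section label_maps.
Context d (T : measurableType d).

(* A finite measurable partition is encoded by a map into a finite type, whose
   fibers are the atoms; joins then become tuples of maps. *)
Definition lmeas (L : Type) (g : T -> L) :=
  forall A : set L, measurable (g @^-1` A).

Lemma lmeas_comp (L M : Type) (phi : L -> M) (g : T -> L) :
  lmeas g -> lmeas (phi \o g).
Proof. by move=> mg A; rewrite comp_preimage; exact: mg. Qed.

(** One representative is chosen for each value taken by [h]; [s0] is the default at the other
    values. *)
Lemma fiber_section (S L : Type) (h : S -> L) (s0 : S) :
  exists r : L -> S, forall x, h (r (h x)) = h x.
Proof.
exists (fun l => if pselect (exists x, h x = l) is left P
                 then projT1 (cid P) else s0).
by move=> x; case: pselect => [P|]; [case: cid|case; exists x].
Qed.

Lemma factorP (S L M : Type) (h : S -> L) (g : S -> M) (s0 : S) :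
  (forall x y, h x = h y -> g x = g y) -> exists phi, g = phi \o h.
Proof.
move=> hg; have [r hr] := fiber_section h s0.
by exists (g \o r); apply/funext => x; apply/hg.
Qed.

Lemma lmeas_factor (L M : Type) (h : T -> L) (g : T -> M) :
  lmeas h -> (forall x y, h x = h y -> g x = g y) -> lmeas g.
Proof. by move=> mh /(factorP point)[phi ->]; exact: lmeas_comp. Qed.

Lemma lmeas_fin (L : finType) (g : T -> L) :
  (forall l, measurable (g @^-1` [set l])) -> lmeas g.
Proof.
move=> mg A.
have -> : g @^-1` A = \bigcup_(l in A) g @^-1` [set l].
  by apply/seteqP; split => [x Ax|x [l Al] /= ->//]; exists (g x).
by apply: fin_bigcup_measurable => [|l _]; [exact: finite_finset|exact: mg].
Qed.

Lemma lmeas_asbool (A : set T) : measurable A -> lmeas (fun x => `[<A x>]).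
Proof.
move=> mA; apply: lmeas_fin => -[].
  rewrite (_ : _ @^-1` _ = A)//.
  by apply/seteqP; split => x /=; case: asboolP.
rewrite (_ : _ @^-1` _ = ~` A); first exact: measurableC.
by apply/seteqP; split => x /=; case: asboolP.
Qed.

Lemma lmeas_pair (L M : finType) (g : T -> L) (h : T -> M) :
  lmeas g -> lmeas h -> lmeas (fun x => (g x, h x)).
Proof.
move=> mg mh; apply: lmeas_fin => -[l m].
rewrite (_ : _ @^-1` _ = g @^-1` [set l] `&` h @^-1` [set m]).
  exact: measurableI.
by apply/seteqP; split => x /= [-> ->].
Qed.

(** The tuple of labels encodes the join of the partitions given by the [F i]; its type is finite
    when [L] is. *)
Definition jtup (I : Type) (s : seq I) (S L : Type) (F : I -> S -> L) (x : S) :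
  (size s).-tuple L := map_tuple (F^~ x) (in_tuple s).

Lemma jtup_eqP (I : eqType) (s : seq I) (S L : Type) (F : I -> S -> L) x y :
  jtup s F x = jtup s F y <-> (forall i, i \in s -> F i x = F i y).
Proof.
split => [/(congr1 val)/= /eq_in_map//|h].
by apply/val_inj => /=; apply/eq_in_map.
Qed.

Lemma jtup_cons_factor (I : eqType) (a : I) (s : seq I) (S L : Type)
  (F : I -> S -> L) x y :
  (F a x, jtup s F x) = (F a y, jtup s F y) ->
  jtup (a :: s) F x = jtup (a :: s) F y.
Proof.
move=> e; have /= Fa := congr1 fst e; have /jtup_eqP Fs := congr1 snd e.
apply: (iffRL (@jtup_eqP _ (a :: s) _ _ F x y)) => i.
by rewrite inE => /predU1P[->|/Fs].
Qed.

Lemma lmeas_jtup (I : eqType) (s : seq I) (L : finType) (F : I -> T -> L) :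
  (forall i, i \in s -> lmeas (F i)) -> lmeas (jtup s F).
Proof.
elim: s => [|a s IH] mF.
  apply: (@lmeas_factor _ _ (fun=> tt)); last by move=> x y _; exact/jtup_eqP.
  move=> A; have [At|At] := pselect (A tt).
    by rewrite (_ : _ @^-1` _ = setT)//; apply/seteqP; split.
  by rewrite (_ : _ @^-1` _ = set0)//; apply/seteqP; split.
apply: (@lmeas_factor _ _ (fun x => (F a x, jtup s F x))).
  apply: lmeas_pair; first by apply: mF; rewrite mem_head.
  by apply: IH => i si; apply: mF; rewrite inE si orbT.
exact: jtup_cons_factor.
Qed.

Context (R : realType) (mu : probability T R).

Definition lprob (L : finType) (g : T -> L) (l : L) : R :=
  fine (mu (g @^-1` [set l])).

Definition lent (L : finType) (g : T -> L) : R := \sum_l eta (lprob g l).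

Lemma lprob_ge0 (L : finType) (g : T -> L) l : 0 <= lprob g l.
Proof. exact/fine_ge0/measure_ge0. Qed.

Lemma lprob_set (L : finType) (g : T -> L) (A : set L) : lmeas g ->
  fine (mu (g @^-1` A)) = \sum_(l | l \in A) lprob g l.
Proof.
move=> mg.
have -> : g @^-1` A = \bigcup_(l in A) g @^-1` [set l].
  by apply/seteqP; split => [x Ax|x [l Al] /= ->//]; exists (g x).
rewrite measure_fin_bigcup//=; last first.
  by move=> i j _ _ [x [/= -> ->]].
rewrite (@fsbigE _ _ _ _ A [seq l <- index_enum L | l \in A]); last 3 first.
- by rewrite filter_uniq// index_enum_uniq.
- by move=> l /=; rewrite mem_filter => /andP[/set_mem].
- by move=> l Al; rewrite mem_filter mem_index_enum andbT mem_set.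
rewrite big_filter_cond; under eq_bigl do rewrite andbb.
rewrite (eq_bigr (fun l => (lprob g l)%:E)) ?sumEFin// => l _.
by rewrite fineK//; exact/fin_num_measure/mg.
Qed.

(** Change of variables for finite laws: the atom of [phi \o h] over [m] is the disjoint union of
    the atoms of [h] whose labels are sent to [m]. *)
Lemma lprob_sum_comp (L M : finType) (h : T -> L) (phi : L -> M) (F : M -> R) :
  lmeas h ->
  \sum_l lprob h l * F (phi l) = \sum_m lprob (phi \o h) m * F m.
Proof.
move=> mh; rewrite (partition_big phi predT)//=; apply: eq_bigr => m _.
rewrite (_ : lprob _ m = \sum_(l | phi l == m) lprob h l); last first.
  rewrite /lprob comp_preimage lprob_set//; apply: eq_bigl => l.
  by apply/idP/eqP => [/set_mem|lm]//; exact/mem_set.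
by rewrite mulr_suml; apply: eq_bigr => l /eqP ->.
Qed.

Lemma lprob_sum1 (L : finType) (g : T -> L) : lmeas g -> \sum_l lprob g l = 1.
Proof.
move=> mg; have := lprob_set setT mg.
rewrite preimage_setT probability_setT /= => ->.
by apply: eq_bigl => l; rewrite in_setT.
Qed.

Lemma lprob_comp_ge (L M : finType) (h : T -> L) (phi : L -> M) l :
  lmeas h -> lprob h l <= lprob (phi \o h) (phi l).
Proof.
move=> mh; have mp : measurable ((phi \o h) @^-1` [set phi l]).
  exact: (lmeas_comp phi mh).
apply: fine_le; [exact/fin_num_measure/mh|exact/fin_num_measure/mp|].
by apply: le_measure => [||x /= ->//]; rewrite inE; [exact: mh|exact: mp].
Qed.

Lemma lprob_le1 (L : finType) (g : T -> L) l : lmeas g -> lprob g l <= 1.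
Proof.
move=> mg; rewrite -(lprob_sum1 mg) (bigD1 l)//= lerDl sumr_ge0// => *.
exact: lprob_ge0.
Qed.

Lemma lent_ge0 (L : finType) (g : T -> L) : lmeas g -> 0 <= lent g.
Proof.
move=> mg; apply: sumr_ge0 => l _.
by apply: eta_ge0; rewrite lprob_ge0 lprob_le1.
Qed.

(** Here [g] factors as [phi \o h]. Both entropies become averages of [- ln] of atom masses over the
    law of [h], and each atom of [g] contains the corresponding atom of [h]. *)
Lemma lent_mono (L M : finType) (h : T -> L) (g : T -> M) :
  lmeas h -> (forall x y, h x = h y -> g x = g y) -> lent g <= lent h.
Proof.
move=> mh /(factorP point)[phi ->].
rewrite /lent /eta sumrN lerNl -sumrN.
under eq_bigr do rewrite opprK.
rewrite -(lprob_sum_comp phi (fun m => ln (lprob (phi \o h) m)) mh).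
apply: ler_sum => l _; have := lprob_ge0 h l.
rewrite le_eqVlt => /predU1P[<-|h0]; first by rewrite !mul0r.
rewrite ler_pM2l// ler_ln ?posrE ?lprob_comp_ge//.
exact: lt_le_trans h0 (lprob_comp_ge _ _ mh).
Qed.

(** Gibbs' inequality for the joint law against the product of its marginals; the logarithm of the
    product splits into the two marginal entropies. *)
Lemma lent_pair (L M : finType) (g : T -> L) (h : T -> M) :
  lmeas g -> lmeas h -> lent (fun x => (g x, h x)) <= lent g + lent h.
Proof.
move=> mg mh; pose k x := (g x, h x).
have mk : lmeas k by exact: lmeas_pair.
pose p (z : L * M) := lprob g z.1; pose q (z : L * M) := lprob h z.2.
have rp z : lprob k z <= p z by exact: (@lprob_comp_ge _ _ k fst z mk).
have rq z : lprob k z <= q z by exact: (@lprob_comp_ge _ _ k snd z mk).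
have r0 z : 0 <= lprob k z by exact: lprob_ge0.
apply: (@le_trans _ _ (\sum_z (- (lprob k z * ln (p z)) - lprob k z * ln (q z)
   + (p z * q z - lprob k z)))).
  apply: ler_sum => z _.
  (* A null marginal forces a null joint mass, as [eta_gibbs] demands. *)
  have pq0 : p z * q z = 0 -> lprob k z = 0.
    move=> /eqP; rewrite mulf_eq0 => /orP[] /eqP e; apply/le_anti.
      by rewrite r0 andbT -e rp.
    by rewrite r0 andbT -e rq.
  have pq : 0 <= p z * q z by rewrite mulr_ge0 ?lprob_ge0.
  apply: le_trans (eta_gibbs (r0 z) pq pq0) _.
  rewrite -addrA lerD2r.
  have := r0 z; rewrite le_eqVlt => /predU1P[<-|k0].
    by rewrite !mul0r; lra.
  rewrite lnM ?posrE; [|exact: lt_le_trans k0 _|exact: lt_le_trans k0 _].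
  by rewrite mulrDr opprD.
rewrite !big_split/= !sumrN (lprob_sum1 mk).
rewrite (lprob_sum_comp fst (fun l => ln (lprob g l)) mk).
rewrite (lprob_sum_comp snd (fun l => ln (lprob h l)) mk).
rewrite -(pair_bigA _ (fun l m => lprob g l * lprob h m))/=.
under [X in _ + (X - _)]eq_bigr do rewrite -mulr_sumr (lprob_sum1 mh) mulr1.
by rewrite (lprob_sum1 mg) subrr addr0 /lent /eta !sumrN.
Qed.

(** Gibbs' inequality against the uniform law on [L]. *)
Lemma lent_card (L : finType) (g : T -> L) : lmeas g ->
  lent g <= ln #|L|%:R.
Proof.
move=> mg; have L0 : (0 : R) < #|L|%:R.
  by rewrite ltr0n; apply/card_gt0P; exists (g point).
apply: (@le_trans _ _ (\sum_l (lprob g l * ln #|L|%:R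
                               + (#|L|%:R^-1 - lprob g l)))).
  apply: ler_sum => l _.
  have i0 : (#|L|%:R^-1 : R) != 0 by rewrite invr_neq0// gt_eqF.
  apply: le_trans (eta_gibbs (q := #|L|%:R^-1) (lprob_ge0 g l) _ _) _.
  - by rewrite invr_ge0 ltW.
  - by move/eqP; rewrite (negbTE i0).
  - by rewrite lnV ?posrE// mulrN opprK addrA.
rewrite big_split/= -mulr_suml lprob_sum1// mul1r.
have sum1 : \sum_(l : L) (#|L|%:R^-1 : R) = 1.
  by rewrite sumr_const -[_ *+ _]mulr_natl divff ?gt_eqF.
by rewrite big_split/= sumrN lprob_sum1// sum1 subrr addr0.
Qed.

Lemma lent_jtup (I : eqType) (s : seq I) (L : finType) (F : I -> T -> L) :
  (forall i, i \in s -> lmeas (F i)) ->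
  lent (jtup s F) <= \sum_(i <- s) lent (F i).
Proof.
elim: s => [|a s IH] mF.
  rewrite big_nil (le_trans (lent_card _))//; first exact: lmeas_jtup.
  by rewrite card_tuple expn0 ln1.
have ms : forall i, i \in s -> lmeas (F i).
  by move=> i si; apply: mF; rewrite inE si orbT.
have ma : lmeas (F a) by apply: mF; rewrite mem_head.
have mjs := lmeas_jtup ms.
rewrite big_cons (le_trans _ (lerD (lexx _) (IH ms)))//.
apply: le_trans (lent_pair ma mjs).
apply: lent_mono; first exact: lmeas_pair.
exact: jtup_cons_factor.
Qed.

(** Continuity at 0 of the entropy of a two-set partition, by Gibbs' inequality against the law
    [(q, 1 - q)]. *)
Lemma lent_asbool_small (e : R) : 0 < e -> exists2 del : R, 0 < del &
  forall A : set T, measurable A -> (mu A < del%:E)%E ->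
  lent (fun x => `[<A x>]) <= e.
Proof.
(* The bound [q <= 1/2] gives [- ln (1 - q) <= 2 * q], which is at most [e / 2] because
   [q <= e / 4]. The other half of [e] bounds [M] times the mass of [A]. *)
move=> e0; pose q : R := Num.min (e / 4) (2^-1).
have q0 : 0 < q by rewrite /q lt_min; apply/andP; split; lra.
have qe : q <= e / 4 by rewrite ge_min lexx.
have q2 : q <= 2^-1 by rewrite ge_min lexx orbT.
have lnq : ln q <= 0 by rewrite ln_le0//; lra.
pose M := 1 - ln q; have M0 : 0 < M by rewrite /M; lra.
exists (e / 2 / M); first by rewrite !divr_gt0.
move=> A mA mudel.
have mb := lmeas_asbool mA.
pose b x := `[<A x>].
have Ab : b @^-1` [set true] = A.
  by apply/seteqP; split => x; rewrite /b /=; case: asboolP.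
have pA : lprob b true * M <= e / 2.
  rewrite /lprob Ab -ler_pdivlMr// -lee_fin fineK ?ltW//.
  exact: fin_num_measure.
have := lprob_sum1 mb; rewrite -/b big_bool/= => p1.
have pt := lprob_ge0 b true; have pf := lprob_ge0 b false.
rewrite /lent big_bool/= -/b.
have h1 : eta (lprob b true) <= - (lprob b true * ln q) + q - lprob b true.
  by apply: eta_gibbs => //; lra.
have h2 : eta (lprob b false) <=
    - (lprob b false * ln (1 - q)) + (1 - q) - lprob b false.
  by apply: eta_gibbs => //; lra.
have h3 : - ln (1 - q) <= 2 * q.
  rewrite -lnV ?posrE; last by lra.
  have -> : (1 - q)^-1 = 1 + q / (1 - q) by field; lra.
  apply: le_trans (le_ln1Dx _) _.
    by apply: (@lt_le_trans _ _ 0); [lra|rewrite divr_ge0//; lra].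
  by rewrite ler_pdivrMr; [nra|lra].
have h4 : - (lprob b false * ln (1 - q)) <= 2 * q.
  rewrite -mulrN; apply: le_trans (_ : 1 * (2 * q) <= _); last by rewrite mul1r.
  by apply: ler_pM => //; [rewrite oppr_ge0 ln_le0//; lra|lra].
have h5 : - (lprob b true * ln q) + lprob b true <= e / 2.
  by apply: le_trans pA; rewrite /M; lra.
lra.
Qed.

(** Indexing by points rather than by labels keeps only the nonempty atoms. *)
Definition fibers (L : Type) (g : T -> L) : set (set T) :=
  range (fun x => g @^-1` [set g x]).

Lemma fibersE (L : Type) (g : T -> L) :
  fibers g = (fun l => g @^-1` [set l]) @` range g.
Proof.
apply/seteqP; split => [_ [x _ <-]|_ [_ [x _ <-] <-]]; last by exists x.
by exists (g x) => //; exists x.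
Qed.

Lemma finite_partition_fibers (L : finType) (g : T -> L) :
  lmeas g -> finite_partition (fibers g).
Proof.
move=> mg; split.
- by rewrite fibersE; apply: finite_image; exact: finite_finset.
- by move=> _ [x _ <-]; exact: mg.
- split.
  + apply/seteqP; split => // x _; exists (g @^-1` [set g x]) => //.
    by exists x.
  + move=> _ _ [x _ <-] [y _ <-] [z [/= zx zy]].
    by rewrite -zx -zy.
  + by move=> _ [x _ <-]; exists x.
Qed.

(** A point is labelled by the vector of its memberships in the listed atoms; disjointness makes the
    fiber through a point of an atom equal to that atom. *)
Lemma finite_partitionP (a : set (set T)) : finite_partition a ->
  exists (L : finType) (g : T -> L), lmeas g /\ a = fibers g.
Proof.
move=> [fa ma [ca ta na]]; have /finite_seqP[s sa] := fa.
exists ((size s).-tuple bool), (jtup s (fun A x => `[<A x>])); split.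
  apply: lmeas_jtup => A As; apply: lmeas_asbool; apply: ma.
  by rewrite sa.
have fib A x : a A -> A x ->
    jtup s (fun A x => `[<A x>]) @^-1` [set jtup s (fun A x => `[<A x>]) x] = A.
  move=> aA Ax; apply/seteqP; split => y /=.
    move=> /jtup_eqP/(_ A); rewrite (asboolT Ax) => h.
    by apply/asboolP/h; move: aA; rewrite sa.
  move=> Ay; apply/jtup_eqP => B Bs.
  have aB : a B by rewrite sa.
  apply/asbool_equiv_eq; split => [By|Bx].
    by rewrite (ta B A)//; exists y.
  by rewrite (ta B A)//; exists x.
apply/seteqP; split => [A aA|_ [x _ <-]].
  by have [x Ax] := na _ aA; exists x => //; exact: fib.
have : (cover a id) x by rewrite ca.
by move=> [A aA Ax]; rewrite (fib A).
Qed.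

Lemma entropy_fibers (L : finType)
  (g : T -> L) : entropy mu (fibers g) = lent g.
Proof.
rewrite /entropy fibersE fsbig_image; last first.
  move=> l m /set_mem[x _ <-] /set_mem[y _ <-] e.
  by have : (g @^-1` [set g y]) x by rewrite -e.
(* Labels that are not attained have empty fibers and contribute 0. *)
rewrite (@fsbig_widen _ _ _ _ _ setT)//; last first.
  move=> l [_ gl] /=; rewrite (_ : _ @^-1` _ = set0) ?measure0 ?mul0r//.
  by apply/seteqP; split => x //= gx; apply: gl; exists x.
rewrite (@fsbigE _ _ _ _ setT (index_enum L)) ?index_enum_uniq//; last first.
  by move=> l _; rewrite mem_index_enum.
by rewrite /lent /eta sumrN; congr (- _); apply: eq_bigl => l; rewrite in_setT.
Qed.

End label_maps.

(** A point of a nonempty intersection forces each factor to be the fiber through its image, so the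
    members of the join are exactly the fibers of the tuple. *)
Lemma partition_join_fibers d d' (S : measurableType d) (T : measurableType d')
  (I : eqType) (s : seq I) (f : I -> S -> T) (L : finType) (g : T -> L) :
  partition_join [set` s] (fun i => preimage_partition (f i) (fibers g)) =
  fibers (jtup s (fun i => g \o f i)).
Proof.
apply/seteqP; split => [B [[x Bx] [A aA eB]]|_ [x _ <-]].
  exists x => //; apply/seteqP; split => y /=.
    move=> /jtup_eqP fyx; rewrite eB => i si.
    move: Bx; rewrite eB => /(_ i si).
    have [_ [z _ <-] <-] := aA i si => /= <-; exact: fyx.
  rewrite eB => By; apply/jtup_eqP => i si.
  move: Bx By; rewrite eB => /(_ i si) + /(_ i si).
  by have [_ [z _ <-] <-] := aA i si => /= -> ->.
split; first by exists x.
exists (fun i => (g \o f i) @^-1` [set g (f i x)]).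
  move=> i si; exists (g @^-1` [set g (f i x)]) => //.
  by exists (f i x).
apply/seteqP; split => y /=; first by move=> /jtup_eqP h i /= si; exact: h.
by move=> h; apply/jtup_eqP => i si; exact: h.
Qed.

Lemma entropy_join d d' (S : measurableType d) (T : measurableType d')
  (R : realType) (mu : probability S R) (I : eqType) (J : set I) (s : seq I)
  (f : I -> S -> T) (L : finType) (g : T -> L) : J = [set` s] ->
  entropy mu (partition_join J (fun i => preimage_partition (f i) (fibers g))) =
  lent mu (jtup s (fun i => g \o f i)).
Proof. by move=> ->; rewrite partition_join_fibers entropy_fibers. Qed.

Lemma set_iota n : `I_n = [set` iota 0 n].
Proof. by apply/seteqP; split => i /=; rewrite mem_iota add0n. Qed.

(** * Measure-preserving maps and subadditive limits *)

Definition measure_preserving d (T : measurableType d) (R : realType)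
    (mu : probability T R) (f : T -> T) :=
  forall A, measurable A -> measurable (f @^-1` A) /\ mu (f @^-1` A) = mu A.

Lemma measure_preserving_iter d (T : measurableType d) (R : realType)
    (mu : probability T R) (f : T -> T) n :
  measure_preserving mu f -> measure_preserving mu (iter n f).
Proof.
move=> mpf A mA; elim: n => [//|n [mn en]].
have [m1 e1] := mpf _ mA.
rewrite (_ : iter n.+1 f @^-1` A = f @^-1` (iter n f @^-1` A)).
  by have [] := mpf _ mn; rewrite en.
by apply/seteqP; split => x /=; rewrite -iterSr.
Qed.

Lemma lmeas_preserving d (T : measurableType d) (R : realType)
    (mu : probability T R) (f : T -> T) (L : Type) (g : T -> L) :
  measure_preserving mu f -> lmeas g -> lmeas (g \o f).
Proof. by move=> mpf mg A; rewrite comp_preimage; apply mpf; exact: mg. Qed.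

Lemma lent_preserving d (T : measurableType d) (R : realType)
    (mu : probability T R) (f : T -> T) (L : finType) (g : T -> L) :
  measure_preserving mu f -> lmeas g -> lent mu (g \o f) = lent mu g.
Proof.
move=> mpf mg; apply: eq_bigr => l _; congr eta.
by rewrite /lprob comp_preimage (mpf _ _).2//; exact: mg.
Qed.

Lemma measurable_preserving d (T : measurableType d) (R : realType)
    (mu : probability T R) (f : T -> T) :
  measure_preserving mu f -> measurable_fun setT f.
Proof. by move=> mpf _ A mA; rewrite setTI; exact: (mpf A mA).1. Qed.

Lemma integral_preserving d (T : measurableType d) (R : realType)
    (mu : probability T R) (f : T -> T) (g : T -> \bar R) :
  measure_preserving mu f -> measurable_fun setT g -> (forall x, 0 <= g x)%E ->
  (\int[mu]_x g (f x) = \int[mu]_x g x)%E.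
Proof.
move=> mpf mg g0; have mf := measurable_preserving mpf.
transitivity (\int[pushforward mu f]_x g x)%E.
  by rewrite (ge0_integral_pushforward mf).
apply: eq_measure_integral => A mA _.
exact: (mpf A mA).2.
Qed.

Lemma integral_cst_probability d (T : measurableType d) (R : realType)
    (mu : probability T R) (c : \bar R) : (\int[mu]_x cst c x = c)%E.
Proof.
rewrite integral_cst// -[RHS]mule1; congr (_ * _)%E; exact: probability_setT.
Qed.

Lemma integral_label d (T : measurableType d) (R : realType)
    (mu : probability T R) (L : finType) (h : T -> L) (F : L -> R) :
  lmeas h -> (forall l, 0 <= F l) ->
  (\int[mu]_x (F (h x))%:E = (\sum_l F l * lprob mu h l)%:E)%E.
Proof.
move=> mh F0; have mi l : measurable (h @^-1` [set l]) by exact: mh.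
transitivity (\int[mu]_x \sum_l ((F l)%:E * (\1_(h @^-1` [set l]) x)%:E))%E.
  apply: eq_integral => x _; rewrite (bigD1 (h x))//= indicE mem_set// mule1.
  rewrite big1 ?adde0// => l lx; rewrite indicE memNset ?mule0// => e.
  by move: lx; rewrite -e eqxx.
have m1 l : measurable_fun setT (fun x => (\1_(h @^-1` [set l]) x)%:E : \bar R).
  by apply/measurable_EFinP; exact: measurable_indic.
rewrite ge0_integral_sum//.
- rewrite -sumEFin; apply: eq_bigr => l _.
  rewrite ge0_integralZl_EFin// integral_indic// setIT EFinM /lprob fineK//.
  exact/fin_num_measure/mi.
- by move=> l; exact: measurable_funeM.
- by move=> l x _; rewrite mule_ge0// lee_fin// indicE; case: (_ \in _).
Qed.

(** Fekete's lemma: the limit is the infimum of [u n / n] over [n > 0]. *)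
Lemma fekete (R : realType) (u : nat -> R) :
  (forall n, 0 <= u n) -> (forall m n, u (m + n)%N <= u m + u n) ->
  cvgn (fun n => n%:R^-1 * u n).
Proof.
move=> u0 usub.
have umul m q : u (q * m)%N <= q%:R * u m + u 0%N.
  elim: q => [|q IH]; first by rewrite !mul0n mul0r add0r.
  rewrite mulSn (le_trans (usub _ _))// -natr1 mulrDl mul1r addrC -addrA.
  by rewrite [X in _ <= _ + X]addrC addrA lerD2r.
pose S := [set n%:R^-1 * u n | n in [set n | (0 < n)%N]].
have S0 : has_inf S.
  split; first by exists (1%:R^-1 * u 1%N), 1%N.
  by exists 0 => _ [n _ <-]; rewrite mulr_ge0// invr_ge0.
apply/cvg_ex; exists (inf S); apply/cvgrPdist_le => /= e e0.
have [_ [m /= m0 <-]] : exists2 x, S x & x < inf S + e / 2.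
  by apply: inf_adherent => //; lra.
move=> mlt; have mR : (0 : R) < m%:R by rewrite ltr0n.
(* With [n = q * m + r] and [r < m], the constant [C] bounds the remainder [u r] together with the
   [u 0] lost in [umul]; [N] ensures [C <= n * (e / 2)]. *)
pose C := u 0%N + \sum_(r < m) u r.
have C0 : 0 <= C by rewrite addr_ge0// sumr_ge0.
pose N := (Num.trunc (C / (e / 2))).+1.
have NC : C / (e / 2) < N%:R by exact: truncnS_gt.
near=> n.
have n0 : (0 < n)%N by near: n; exact: nbhs_infty_gt.
have nR : (0 : R) < n%:R by rewrite ltr0n.
have nN : (N <= n)%N by near: n; exact: nbhs_infty_ge.
have infle : inf S <= n%:R^-1 * u n.
  by apply: ge_inf; [exact: S0.2|exists n].
have ue : n%:R^-1 * u n <= inf S + e.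
  rewrite mulrC ler_pdivrMr//.
  have ur : u (n %% m)%N <= \sum_(r < m) u r.
    have mm : (n %% m < m)%N by rewrite ltn_mod.
    rewrite (bigD1 (Ordinal mm))//= lerDl sumr_ge0//.
  have un : u n <= (n %/ m)%N%:R * u m + C.
    rewrite {1}(divn_eq n m) (le_trans (usub _ _))// /C addrA.
    exact: lerD.
  have qm : (n %/ m)%N%:R * u m <= n%:R * (m%:R^-1 * u m).
    rewrite mulrA ler_wpM2r// ler_pdivlMr// -natrM ler_nat.
    exact: leq_trunc_div.
  have h1 : n%:R * (m%:R^-1 * u m) <= n%:R * (inf S + e / 2).
    by rewrite ler_wpM2l// ltW.
  have h2 : C <= n%:R * (e / 2).
    rewrite -ler_pdivrMr; last by lra.
    by rewrite (le_trans (ltW NC))// ler_nat.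
  have -> : (inf S + e) * n%:R = n%:R * (inf S + e / 2) + n%:R * (e / 2).
    by field.
  lra.
by rewrite distrC ger0_norm ?subr_ge0//; lra.
Unshelve. all: by end_near. Qed.

(** The last [n] labels of an orbit of length [m + n] are the first [n] labels pulled back by
    [iter m f], which preserves [mu]; hence the entropies are subadditive. *)
Lemma lent_iter_cvg d (T : measurableType d) (R : realType)
    (mu : probability T R) (f : T -> T) (L : finType) (g : T -> L) :
  measure_preserving mu f -> lmeas g ->
  cvgn (fun n => n%:R^-1 * lent mu (jtup (iota 0 n) (fun i => g \o iter i f))).
Proof.
move=> mpf mg.
have mpi i := measure_preserving_iter i mpf.
have mgi i : lmeas (g \o iter i f) := lmeas_preserving (mpi i) mg.
have mj n : lmeas (jtup (iota 0 n) (fun i => g \o iter i f)).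
  by apply: lmeas_jtup => i _.
apply: (@fekete _
  (fun n => lent mu (jtup (iota 0 n) (fun i => g \o iter i f)))) => [n|m n].
  by apply: lent_ge0; exact: mj.
have mjn := lmeas_preserving (mpi m) (mj n).
rewrite /= -[X in _ <= _ + X](lent_preserving (mpi m) (mj n)).
apply: le_trans (lent_pair mu (mj m) mjn).
apply: lent_mono; first exact: lmeas_pair (mj m) mjn.
move=> x y e; have /jtup_eqP e1 := congr1 fst e.
have /jtup_eqP e2 := congr1 snd e.
apply/jtup_eqP => i; rewrite mem_iota add0n => /= imn.
have [im|mi] := ltnP i m; first by apply: e1; rewrite mem_iota.
have /= := e2 (i - m)%N; rewrite -!iterD subnK//; apply.
by rewrite mem_iota add0n/= ltn_subLR.
Qed.

(** * The rotation and the skew product *)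

(** The pushforward gives each interval its length, so it is Lebesgue measure by uniqueness. *)
Lemma lebesgue_measure_translate (R : realType) (c : R) (A : set R) :
  measurable A -> lebesgue_measure ((fun u => u + c) @^-1` A) =
  lebesgue_measure A.
Proof.
move=> mA; pose tr : R -> measurableTypeR R := fun u => u + c.
have mtr : measurable_fun setT tr by apply: measurable_funD.
apply/esym; apply: (@lebesgue_measure_unique _
  (pushforward lebesgue_measure tr)) => //= _ [[a b]] _ <-.
rewrite /pushforward (_ : tr @^-1` _ = `]a - c, b - c]%classic).
  rewrite !lebesgue_measure_itv/= !lte_fin ltrD2r; case: ifP => // _.
  by rewrite -?EFinB; congr EFin; ring.
by apply/seteqP; split => u /=; rewrite /tr !in_itv/= ltrBlDr lerBrDr.
Qed.

Lemma floorBz (R : realType) (x : R) (n : int) :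
  Num.floor (x - n%:~R) = Num.floor x - n.
Proof. by rewrite -intrN floorDrz ?intr_int// intrKfloor. Qed.

Section floor.
Context {R : realType}.
Implicit Types (t s : torus R) (x : R).

(* [t |-> floor (t + x)] is a step function on the torus, whose only jump is
   at this point. *)
Definition cut x : R := (Num.floor x + 1)%:~R - x.

Lemma torus_val_itv t : 0 <= torus_val t < 1.
Proof. by case: t. Qed.

Lemma floor_cut t x :
  Num.floor (torus_val t + x) =
  if cut x <= torus_val t then Num.floor x + 1 else Num.floor x.
Proof.
case: t => t /= t01; rewrite /cut /=.
have /andP[t0 t1] := t01.
have /andP[xl xu] := floor_itv x; rewrite intrD in xu.
case: leP; rewrite intrD => h; apply: floor_def; rewrite !intrD; lra.
Qed.

Lemma floor_torus_eq t s x :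
  (cut x <= torus_val t) = (cut x <= torus_val s) ->
  Num.floor (torus_val t + x) = Num.floor (torus_val s + x).
Proof. by rewrite !floor_cut => ->. Qed.

Lemma torus_val_iter_rot (beta : R) n t :
  torus_val (iter n (rot beta) t) =
  torus_val t + n%:R * beta - (Num.floor (torus_val t + n%:R * beta))%:~R.
Proof.
elim: n => [|n IH].
  rewrite mul0r addr0 /= (_ : Num.floor _ = 0) ?subr0//.
  by apply: floor_def; rewrite add0r; case: t.
have rotE (r : torus R) : torus_val (rot beta r) =
  torus_val r + beta - (Num.floor (torus_val r + beta))%:~R by [].
rewrite iterS rotE IH; set y := torus_val t + n%:R * beta.
have -> : torus_val t + n.+1%:R * beta = y + beta.
  by rewrite /y -natr1 mulrDl mul1r addrA.
by rewrite (addrAC y) floorBz intrB; lra.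
Qed.

(** Since [0 <= t < 1] and the floor loses less than 1, the integer stays within distance 1 of
    [i * beta]. *)
Lemma floor_in_strip (beta : R) (i n : nat) t : (i < n)%N ->
  strip_upto beta 1 n (i%:Z, Num.floor (torus_val t + i%:R * beta)).
Proof.
move=> i_n; split => /=; last by lia.
have /andP[t0 t1] := torus_val_itv t.
have /andP[fl fu] := floor_itv (torus_val t + i%:R * beta).
by rewrite intrD in fu; rewrite /strip /= -?pmulrn; lra.
Qed.

(** For [0 <= q < 1], the fractional part of [t + n * beta] is at least [q] exactly when subtracting
    [q] does not change the floor. For other [q] the comparison has the same answer at all
    points. *)
Lemma le_iter_rot (beta q : R) n t s :
  Num.floor (torus_val t + n%:R * beta) =
  Num.floor (torus_val s + n%:R * beta) ->
  Num.floor (torus_val t + (n%:R * beta - q)) =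
  Num.floor (torus_val s + (n%:R * beta - q)) ->
  (q <= torus_val (iter n (rot beta) t)) =
  (q <= torus_val (iter n (rot beta) s)).
Proof.
have [q0 _ _|q0] := ltP q 0.
  by rewrite !(ltW (lt_le_trans q0 _))//; case/andP: (torus_val_itv
    (iter n (rot beta) s)) (torus_val_itv (iter n (rot beta) t)) => ? ? /andP[].
have [q1 _ _|q1] := leP 1 q.
  by rewrite !leNgt !(lt_le_trans _ q1)//; case/andP: (torus_val_itv
    (iter n (rot beta) s)) (torus_val_itv (iter n (rot beta) t)) => ? ? /andP[].
have qE r : (q <= torus_val (iter n (rot beta) r)) =
    (Num.floor (torus_val r + (n%:R * beta - q)) ==
     Num.floor (torus_val r + n%:R * beta)).
  rewrite torus_val_iter_rot addrA.
  set y := torus_val r + _; rewrite floor_eq.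
  have /andP[yl yu] := floor_itv y; rewrite intrD in yu *.
  by apply/idP/andP => [h|[h _]]; [split|]; lra.
by move=> e1 e2; rewrite !qE e1 e2.
Qed.

End floor.

Section rotation.
Context {R : realType}.
Implicit Types beta : R.

Lemma measurable_torus_ge x : measurable [set t : torus R | x <= torus_val t].
Proof.
exists `[x, +oo[%classic => //; rewrite setTI.
by apply/seteqP; split => t /=; rewrite in_itv/= andbT.
Qed.

(** With [c] the fractional part of [beta], the rotation translates the part of the circle below
    [1 - c] by [c] and the rest by [c - 1]. The sets [E1] and [E2] are the preimages inside these
    two pieces. *)
Lemma measure_preserving_rot beta :
  measure_preserving (@torus_leb R) (rot beta).
Proof.
move=> _ [B mB <-]; rewrite setTI.
pose f := (Num.floor beta)%:~R : R; pose c := beta - f.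
have /andP[fb bf] : 0 <= c < 1.
  by rewrite /c /f; have := floor_itv beta; rewrite intrD; lra.
pose B1 := B `&` `[c, 1[%classic; pose B2 := B `&` `[0, c[%classic.
have mB1 : measurable B1 by exact: measurableI.
have mB2 : measurable B2 by exact: measurableI.
pose E1 := (fun u : R => u + c) @^-1` B1.
pose E2 := (fun u : R => u + (c - 1)) @^-1` B2.
have mtr (x : R) (A : set R) : measurable A ->
    measurable ((fun u : R => u + x) @^-1` A).
  move=> mA; rewrite -[X in measurable X]setTI.
  by apply: (measurable_funD (@measurable_id _ _ setT) (measurable_cst x)).
have mE1 : measurable E1 by exact: mtr.
have mE2 : measurable E2 by exact: mtr.
have rE (t : torus R) : torus_val (rot beta t) =
    if 1 - c <= torus_val t then torus_val t + (c - 1) else torus_val t + c.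
  rewrite {1}/torus_val/= floor_cut /cut intrD.
  have -> : (Num.floor beta)%:~R + 1 - beta = 1 - c by rewrite /c /f; lra.
  by case: ifP => _; rewrite ?intrD /c /f; lra.
have preE : rot beta @^-1` (@torus_val R @^-1` B) =
    @torus_val R @^-1` (E1 `|` E2).
  apply/funext => t; rewrite -[LHS]/(B (torus_val (rot beta t))) rE.
  rewrite -[RHS]/((E1 `|` E2) (torus_val t)); apply/propext.
  have := torus_val_itv t.
  move: (torus_val t) => u /andP[u0 u1].
  rewrite /E1 /E2 /B1 /B2 /= !in_itv/=; split.
  - by case: (leP (1 - c) u) => h Bu; [right|left]; split => //; lra.
  - by case: (leP (1 - c) u) => h [] [Bu /andP[? ?]] //; lra.
split.
  by rewrite preE; exists (E1 `|` E2); [exact: measurableU|rewrite setTI].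
have imE (A : set R) :
    @torus_val R @` (@torus_val R @^-1` A) = A `&` `[0, 1[%classic.
  apply/seteqP; split => [_ [[t t01] At <-]|t [At]].
    by split => //=; rewrite in_itv.
  by rewrite /= in_itv => t01; exists (exist _ t t01).
rewrite preE /= /torus_leb !imE.
have -> : (E1 `|` E2) `&` `[0, 1[%classic = E1 `|` E2.
  apply/setIidl => u; rewrite /E1 /E2 /B1 /B2 /= !in_itv/=.
  by move=> [] [_ /andP[? ?]]; lra.
have -> : B `&` `[0, 1[%classic = B1 `|` B2.
  rewrite /B1 /B2 -setIUr; congr (_ `&` _); apply/seteqP.
  split => u /=; rewrite !in_itv/=.
    by case: (leP c u) => h /andP[? ?]; [left|right]; lra.
  by move=> [] /andP[? ?]; lra.
rewrite !measureU//.
- by congr (_ + _)%E; exact: lebesgue_measure_translate.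
- rewrite /B1 /B2; apply/seteqP; split => u //=; rewrite !in_itv/=.
  by move=> [[_ /andP[? ?]] [_ /andP[? ?]]]; lra.
- rewrite /E1 /E2 /B1 /B2; apply/seteqP; split => u //=; rewrite !in_itv/=.
  by move=> [[_ /andP[? ?]] [_ /andP[? ?]]]; lra.
Qed.

End rotation.

Section skew.
Context (R : realType) (X : pmetricType R).
Variables (T : int * int -> X -> X) (mu : probability (borel X) R) (beta : R).
Hypotheses (actT : Z2_action T) (invT : Z2_invariant T mu).

Lemma action_add w u x : T w (T u x) = T (w + u) x.
Proof. by have [_ Tadd _] := actT; have /(congr1 (@^~ x)) := Tadd w u. Qed.

Lemma measurable_action w :
  measurable_fun setT (T w : borel X -> borel X).
Proof.
apply: (@measurability _ _ (borel X) (borel X) setT (T w) (@open X) erefl)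
  => _ [U oU <-]; rewrite setTI.
apply: sub_sigma_algebra; have [/(_ w)[cT _] _ _] := actT.
by move/continuousP: cT; exact.
Qed.

Lemma measure_preserving_action w : measure_preserving mu (T w).
Proof.
move=> A mA; split; last exact: invT.
by rewrite -[X in measurable X]setTI; exact: measurable_action.
Qed.

(** The step at time [n] is vertically [floor (t + (n + 1) * beta) - floor (t + n * beta)], because
    the floor commutes with integer translations; the sum telescopes. *)
Lemma cocycleE n t :
  cocycle T beta n t = T (n%:Z, Num.floor (torus_val t + n%:R * beta)).
Proof.
have [_ _ T0] := actT.
elim: n => [|n IH].
  rewrite /= mul0r addr0 (_ : Num.floor _ = 0) ?T0//.
  by apply: floor_def; rewrite add0r; case: t.
apply/funext => x /=; rewrite IH /cocycle1 action_add; congr T.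
transitivity (1 + n%:Z, Num.floor (beta + torus_val (iter n (rot beta) t)) +
  Num.floor (torus_val t + n%:R * beta)) => //.
congr (_, _); rewrite torus_val_iter_rot [X in Num.floor X]addrC.
set y := torus_val t + n%:R * beta.
rewrite addrAC floorBz subrK /y -natr1 mulrDl mul1r addrA//.
Qed.

Lemma iter_skew_product n (p : torus R * borel X) :
  iter n (skew_product T beta) p =
  (iter n (rot beta) p.1, cocycle T beta n p.1 p.2).
Proof. by case: p => t x; elim: n => //= n ->. Qed.

Lemma measurable_skew_product :
  measurable_fun setT (skew_product T beta).
Proof.
pose phi n : torus R * borel X -> torus R * borel X :=
  fun p => (rot beta p.1, T (1, n) p.2).
have mphi n : measurable_fun setT (phi n).
  apply: measurable_fun_pair.
    exact: (measurableT_comp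
      (measurable_preserving (measure_preserving_rot beta))
      measurable_fst).
  exact: (measurableT_comp (measurable_action (1, n)) measurable_snd).
(* Only two vertical steps occur, one on each side of [cut beta], so the map is glued from two
   measurable ones. *)
have -> : skew_product T beta = fun p =>
    if cut beta <= torus_val p.1 then phi (Num.floor beta + 1) p
    else phi (Num.floor beta) p.
  apply/funext => p; rewrite /skew_product /cocycle1 addrC floor_cut.
  by case: ifP.
apply: measurable_fun_ifT => //.
apply: (@measurable_fun_bool _ _ _ _ true).
rewrite setTI (_ : _ @^-1` _ =
  (fst : torus R * borel X -> _) @^-1` [set t | cut beta <= torus_val t])//.
rewrite -[X in measurable X]setTI; apply: measurable_fst => //.
exact: measurable_torus_ge.
Qed.

(** The section at [t] of the preimage of [C] is the preimage under some [T w] of the section of [C]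
    at [rot beta t]. Invariance of [mu] treats the fibers, invariance under the rotation treats the
    base. *)
Lemma measure_preserving_skew_product :
  measure_preserving (skew_measure mu) (skew_product T beta).
Proof.
move=> C mC; split.
  by rewrite -[X in measurable X]setTI; exact: measurable_skew_product.
rewrite /skew_measure /= /product_measure1.
transitivity (\int[@torus_leb R]_t
    (((mu \o xsection C) \o rot beta) t))%E.
  apply: eq_integral => t _ /=.
  rewrite -[RHS](invT (1, Num.floor (beta + torus_val t))).
    congr (mu _); apply/seteqP; split => x /=;
      by rewrite /xsection /= ?inE.
  exact: measurable_xsection.
apply: (integral_preserving (measure_preserving_rot beta)) => //.
exact: measurable_fun_xsection.
Qed.

End skew.

(** * Approximation in the product sigma-algebra *)

Section approximation.
Context (R : realType) (X : pmetricType R) (mu : probability (borel X) R).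

Local Notation Om := (torus R).
Local Notation mt := (skew_measure mu).

(** [D] is a union of cells of the grid cut out by the thresholds [Q] and the sets [Bs]. One
    implication suffices, since the two conditions are symmetric in [p] and [p']. *)
Definition determined_by (Q : seq R) (Bs : seq (set (borel X)))
    (D : set (Om * borel X)) :=
  forall p p',
    (forall q, q \in Q -> (q <= torus_val p.1) = (q <= torus_val p'.1)) ->
    (forall B, B \in Bs -> `[<B p.2>] = `[<B p'.2>]) -> D p -> D p'.

(* Equivalently: finite unions of rectangles [I `*` B] with [I] an interval and
   [B] a Borel set. *)
Definition elementary (D : set (Om * borel X)) := measurable D /\
  exists Q Bs, (forall B, B \in Bs -> measurable B) /\ determined_by Q Bs D.

Lemma elementaryC D : elementary D -> elementary (~` D).
Proof.
move=> [mD [Q [Bs [mBs dD]]]]; split; first exact: measurableC.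
exists Q, Bs; split => // p p' hQ hB Dp Dp'; apply: Dp; apply: dD Dp'.
  by move=> q /hQ.
by move=> B /hB.
Qed.

Lemma elementaryU D E : elementary D -> elementary E -> elementary (D `|` E).
Proof.
move=> [mD [Q [Bs [mBs dD]]]] [mE [Q' [Bs' [mBs' dE]]]].
split; first exact: measurableU.
exists (Q ++ Q'), (Bs ++ Bs'); split.
  by move=> B; rewrite mem_cat => /orP[/mBs|/mBs'].
move=> p p' hQ hB [Dp|Ep]; [left; apply: dD Dp|right; apply: dE Ep].
- by move=> q Qq; apply: hQ; rewrite mem_cat Qq.
- by move=> B BB; apply: hB; rewrite mem_cat BB.
- by move=> q Qq; apply: hQ; rewrite mem_cat Qq orbT.
- by move=> B BB; apply: hB; rewrite mem_cat BB orbT.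
Qed.

Lemma elementary_ge (x : R) :
  elementary (fst @^-1` [set t : Om | x <= torus_val t]).
Proof.
split.
  rewrite -[X in measurable X]setTI; apply: measurable_fst => //.
  exact: measurable_torus_ge.
by exists [:: x], [::]; split => // p p' /(_ x (mem_head _ _)) /= ->.
Qed.

Lemma elementary_snd (B : set (borel X)) : measurable B ->
  elementary (snd @^-1` B : set (Om * borel X)).
Proof.
move=> mB; split.
  by rewrite -[X in measurable X]setTI; exact: measurable_snd.
exists [::], [:: B]; split; first by move=> A; rewrite inE => /eqP ->.
move=> p p' _ /(_ B (mem_head _ _)) /= BB Bp; apply/asboolP.
by rewrite -BB; exact/asboolP.
Qed.

(** These sets form a sigma-algebra containing the rectangles, hence exhaust the measurable sets. *)
Definition approximable (C : set (Om * borel X)) := measurable C /\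
  forall e : R, 0 < e -> exists2 D, elementary D & (mt (C `+` D) < e%:E)%E.

Let measurableY (C D : set (Om * borel X)) :
  measurable C -> measurable D -> measurable (C `+` D).
Proof. by move=> mC mD; apply: measurableU; exact: measurableD. Qed.

Lemma elementary_approximable D : elementary D -> approximable D.
Proof.
move=> eD; split; first exact: eD.1.
by move=> e e0; exists D => //; rewrite setYK measure0 lte_fin.
Qed.

Lemma approximableC C : approximable C -> approximable (~` C).
Proof.
move=> [mC aC]; split; first exact: measurableC.
move=> e /aC[D eD CD]; exists (~` D); first exact: elementaryC.
rewrite (_ : ~` C `+` ~` D = C `+` D)//; apply/seteqP.
by split => x /=; have [?|?] := pselect (C x);
  have [?|?] := pselect (D x); tauto.
Qed.

(** Triangle inequality for the measure of the symmetric difference. *)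
Lemma approximable_le C C' e e' : measurable C -> approximable C' ->
  0 < e' -> (mt (C `+` C') <= e%:E)%E ->
  exists2 D, elementary D & (mt (C `+` D) < (e + e')%:E)%E.
Proof.
move=> mC [mC' aC'] e'0 CC'; have [D eD C'D] := aC' _ e'0.
exists D => //; have mD := eD.1.
apply: (@le_lt_trans _ _ (mt ((C `+` C') `|` (C' `+` D)))).
  apply: le_measure; rewrite ?inE; [exact: measurableY|..].
    by apply: measurableU; exact: measurableY.
  by move=> x /=; have [?|?] := pselect (C' x); tauto.
apply: le_lt_trans (measureU2 _ _ _) _;
  [exact: measurableY|exact: measurableY|].
by rewrite EFinD lee_ltD// fin_num_measure//; exact: measurableY.
Qed.

Lemma approximableU C C' :
  approximable C -> approximable C' -> approximable (C `|` C').
Proof.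
move=> [mC aC] [mC' aC']; split; first exact: measurableU.
move=> e e0; have e20 : 0 < e / 2 by lra.
have [D eD CD] := aC _ e20; have [D' eD' CD'] := aC' _ e20.
have mD := eD.1; have mD' := eD'.1.
exists (D `|` D'); first exact: elementaryU.
apply: (@le_lt_trans _ _ (mt ((C `+` D) `|` (C' `+` D')))).
  apply: le_measure; rewrite ?inE.
  - by apply: measurableY; exact: measurableU.
  - by apply: measurableU; exact: measurableY.
  - by move=> x /=; tauto.
apply: le_lt_trans (measureU2 _ _ _) _;
  [exact: measurableY|exact: measurableY|].
by rewrite [e]splitr EFinD lteD.
Qed.

Lemma approximable0 : approximable set0.
Proof.
apply: elementary_approximable; split => //.
by exists [::], [::]; split => // p p' _ _ [].
Qed.

(** A finite partial union replaces the whole union: the remainders [G n] decrease to the empty set,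
    so their measures tend to 0. *)
Lemma approximable_bigcup (F : nat -> set (Om * borel X)) :
  (forall n, approximable (F n)) -> approximable (\bigcup_n F n).
Proof.
move=> aF; have mF n : measurable (F n) by have [] := aF n.
have mU : measurable (\bigcup_n F n) by exact: bigcupT_measurable.
split=> // e e0; pose U n := \big[setU/set0]_(i < n) F i.
have aU n : approximable (U n).
  rewrite /U; elim: n => [|n IH].
    by rewrite big_ord0; exact: approximable0.
  by rewrite big_ord_recr/=; exact: approximableU.
have UF n : U n `<=` \bigcup_n F n.
  by move=> x; rewrite /U -bigcup_mkord => -[k _ Fx]; exists k.
pose G n := \bigcup_n F n `\` U n.
have mG n : measurable (G n) by apply: measurableD => //; have [] := aU n.
have Gcap : \bigcap_n G n = set0.
  apply/seteqP; split => // x Gx; have [[k _ Fkx] _] := Gx 0%N I.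
  have [_] := Gx k.+1 I; apply; rewrite /U -bigcup_mkord.
  by exists k => //=.
have Gcvg : (mt \o G) @ \oo --> mt (\bigcap_n G n).
  apply: nonincreasing_cvg_mu => //.
  - by rewrite -ge0_fin_numE ?fin_num_measure.
  - by rewrite Gcap.
  - move=> i j ij; apply/subsetPset => x [Fx Ux]; split => // Ui; apply: Ux.
    move: Ui; rewrite /U -!bigcup_mkord => -[k /= ki Fk]; exists k => //=.
    exact: leq_trans ij.
have [n Gn] : exists n, (mt (G n) < (e / 2)%:E)%E.
  apply: contrapT => /forallNP nG.
  have : ((e / 2)%:E <= limn (mt \o G))%E.
    apply: lime_ge; first by apply/cvg_ex; eexists; exact: Gcvg.
    by apply: nearW => n; rewrite leNgt; apply/negP; exact: nG.
  by rewrite (cvg_lim _ Gcvg)// Gcap measure0 lee_fin; lra.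
have [] := @approximable_le (\bigcup_n F n) (U n) (e / 2) (e / 2) mU (aU n).
- by lra.
- apply: le_trans (ltW Gn); apply: le_measure; rewrite ?inE//.
    by apply: measurableY => //; have [] := aU n.
  by move=> x [//|[Ux]]; have := UF n x Ux.
- by move=> D eD; rewrite -splitr => h; exists D.
Qed.

(** The sets with approximable preimage form a sigma-algebra, so generators suffice. It is applied
    to rectangles in the product and to rays on the line. *)
Lemma approximable_preimage (S : Type) (f : Om * borel X -> S)
    (G : set (set S)) :
  (forall A, G A -> approximable (f @^-1` A)) ->
  forall A, <<s G >> A -> approximable (f @^-1` A).
Proof.
move=> GA; apply: smallest_sub => //; split.
- by rewrite /= preimage_set0; exact: approximable0.
- move=> A /= aA; rewrite setTD preimage_setC; exact: approximableC.
- by move=> F aF /=; rewrite preimage_bigcup; exact: approximable_bigcup.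
Qed.

Lemma measurable_approximable C : measurable C -> approximable C.
Proof.
rewrite measurable_prod_measurableType.
apply: (@approximable_preimage _ id) => _ [A mA [B mB <-]].
have aA : approximable (fst @^-1` A).
  have [A' mA' <-] := mA; rewrite setTI.
  rewrite (_ : _ @^-1` _ = (@torus_val R \o fst) @^-1` A')//.
  move: A' mA'; have -> : measurable = <<s @RGenCInfty.G R >> :> set (set R).
    exact: RGenCInfty.measurableE.
  apply: approximable_preimage => _ [x ->].
  rewrite (_ : _ @^-1` _ = fst @^-1` [set t : Om | x <= torus_val t]).
    exact/elementary_approximable/elementary_ge.
  by apply/seteqP; split => p /=; rewrite in_itv/= andbT.
have aB := elementary_approximable (elementary_snd mB).
rewrite (_ : id @^-1` _ = ~` (~` (fst @^-1` A) `|` ~` (snd @^-1` B))).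
  by apply/approximableC/approximableU; exact: approximableC.
by rewrite -setCI setCK.
Qed.

(** The atom of label [l] is the symmetric difference of [D l] and [E l]. The grid given by [Q] and
    [Bs] determines every [D l], and [err] records membership in every [E l], so together they
    determine [c]. *)
Lemma approximate_label (L : finType) (c : Om * borel X -> L) (e : R) :
  lmeas c -> 0 < e ->
  exists (Q : seq R) (Bs : seq (set (borel X))) (M : finType)
    (err : Om * borel X -> M),
  [/\ forall B, B \in Bs -> measurable B, lmeas err, lent mt err <= e &
    forall p p',
      (forall q, q \in Q -> (q <= torus_val p.1) = (q <= torus_val p'.1)) ->
      (forall B, B \in Bs -> `[<B p.2>] = `[<B p'.2>]) ->
      err p = err p' -> c p = c p'].
Proof.
move=> mc e0.
have L0 : (0 : R) < #|L|%:R.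
  by rewrite ltr0n; apply/card_gt0P; exists (c point).
(* The allowance [e] is shared equally among the [#|L|] error sets. *)
have [del del0 delP] := lent_asbool_small mt (divr_gt0 e0 L0).
have /choice[D DP] : forall l, exists D, elementary D /\
    (mt ((c @^-1` [set l]) `+` D) < del%:E)%E.
  move=> l; have [_ /(_ _ del0)[D eD De]] :=
    measurable_approximable (mc [set l]).
  by exists D.
have /choice[Q QP] : forall l, exists Q, exists Bs,
    (forall B, B \in Bs -> measurable B) /\ determined_by Q Bs (D l).
  by move=> l; have [[_ ?] _] := DP l.
have /choice[Bs BsP] := QP.
pose QQ := flatten [seq Q l | l <- enum L].
pose BB := flatten [seq Bs l | l <- enum L].
pose E l := (c @^-1` [set l]) `+` D l.
have mE l : measurable (E l).
  have mD : measurable (D l) by have [[]] := DP l.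
  by apply: measurableU; apply: measurableD => //; exact: mc.
pose err : Om * borel X -> (size (enum L)).-tuple bool :=
  jtup (enum L) (fun l p => `[<E l p>]).
have merr : lmeas err by apply: lmeas_jtup => l _; exact: lmeas_asbool.
have lerr : lent mt err <= e.
  apply: le_trans (lent_jtup mt _) _ => [l _|]; first exact: lmeas_asbool.
  apply: (@le_trans _ _ (\sum_(l <- enum L) (e / #|L|%:R))).
    by apply: ler_sum => l _; apply: delP => //; have [] := DP l.
  rewrite big_enum/= sumr_const -[_ *+ _]mulr_natr divfK// gt_eqF//.
exists QQ, BB, ((size (enum L)).-tuple bool), err; split => //.
  by move=> B /flattenP[_ /mapP[l _ ->]]; exact: (BsP l).1.
move=> p p' hQ hB /jtup_eqP hE.
(* Only the atom of label [c p] matters: [p] lies in it, and agreement on its [D] and [E] puts [p']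
   in it too. *)
have Dpp : D (c p) p <-> D (c p) p'.
  have hQl q : q \in Q (c p) -> (q <= torus_val p.1) = (q <= torus_val p'.1).
    move=> qQ; apply: hQ; apply/flattenP; exists (Q (c p)) => //.
    by apply/mapP; exists (c p); rewrite ?mem_enum.
  have hBl B : B \in Bs (c p) -> `[<B p.2>] = `[<B p'.2>].
    move=> BB'; apply: hB; apply/flattenP; exists (Bs (c p)) => //.
    by apply/mapP; exists (c p); rewrite ?mem_enum.
  by split; apply: (BsP (c p)).2 => // [q /hQl|B /hBl].
have Epp : E (c p) p <-> E (c p) p'.
  have := hE (c p); rewrite mem_enum => /(_ isT) h.
  by split => /asboolP; [rewrite h|rewrite -h] => /asboolP.
have [/= -> //|nc] := pselect ((c @^-1` [set c p]) p').
have [Dp|nDp] := pselect (D (c p) p).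
  have /Epp : E (c p) p' by right; split => //; exact/Dpp.
  by move=> [[_ /(_ Dp)]|[_ []]].
have /Epp : E (c p) p by left.
by move=> [[/nc]|[/Dpp]].
Qed.

End approximation.

(** * Comparison of the entropies *)

Lemma count_sub_eq (T : eqType) (a b : pred T) (s : seq T) :
  subpred a b -> count a s = count b s -> {in s, a =1 b}.
Proof.
move=> ab; elim: s => [//|x s IH] /= e.
have abs := sub_count ab s.
have xab : (a x <= b x)%N by case: (a x) (ab x) => // ->.
have [ex es] : a x = b x /\ count a s = count b s.
  have exn : a x = b x :> nat by apply/eqP; rewrite eqn_leq xab/=; lia.
  by split; [case: (a x) (b x) exn => [] []|lia].
by move=> y; rewrite inE => /predU1P[->//|]; exact: IH.
Qed.

(** * Intervals of the circle cut at finitely many thresholds *)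

Section cuts.
Context {R : realType}.
Implicit Types (P : seq R) (t s : torus R).

(** Counting thresholds needs only [size P + 1] labels, where recording each comparison would need
    [2 ^ size P]; this makes the entropy logarithmic in [size P]. *)
Definition cutidx P t : 'I_(size P).+1 :=
  inord (count (fun p => p <= torus_val t) P).

(** The smaller of two points passes a subset of the thresholds passed by the larger, so equal
    counts mean equal subsets. *)
Lemma cutidx_eq P t s : cutidx P t = cutidx P s ->
  forall p, p \in P -> (p <= torus_val t) = (p <= torus_val s).
Proof.
move=> /(congr1 (@nat_of_ord _)).
rewrite /cutidx !inordK ?ltnS ?count_size// => e.
have [ts|/ltW st] := leP (torus_val t) (torus_val s).
  by apply: count_sub_eq e => p /le_trans; exact.
move=> p pP; apply/esym; apply: (count_sub_eq _ (esym e)) pP => q /le_trans.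
exact.
Qed.

Lemma lmeas_ge (p : R) : lmeas (fun t : torus R => p <= torus_val t).
Proof.
rewrite (_ : (fun _ => _) = fun t => `[<[set t | p <= torus_val t] t>]).
  by apply: lmeas_asbool; exact: measurable_torus_ge.
by apply/funext => t; rewrite asboolb.
Qed.

Lemma lmeas_cutidx P : lmeas (cutidx P).
Proof.
apply: (@lmeas_factor _ _ _ _ (jtup P (fun p t => p <= torus_val t))).
  by apply: lmeas_jtup => p _; exact: lmeas_ge.
move=> t s /jtup_eqP ts; rewrite /cutidx; congr inord.
exact: eq_in_count.
Qed.

End cuts.

(** Concavity of [eta], by Gibbs' inequality against the mean [P]: the linear corrections average to
    0. *)
Lemma eta_jensen (R : realType) (K : finType) (lam p : K -> R) :
  (forall k, 0 <= lam k) -> \sum_k lam k = 1 -> (forall k, 0 <= p k) ->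
  \sum_k lam k * eta (p k) <= eta (\sum_k lam k * p k).
Proof.
move=> l0 l1 p0; set P := \sum_k lam k * p k.
have lp0 k : 0 <= lam k * p k by rewrite mulr_ge0.
have P0 : 0 <= P by rewrite sumr_ge0.
(* If the mean is 0, every [lam k * p k] vanishes, and so does the left-hand side. *)
have [PE|PN] := eqVneq P 0.
  rewrite PE /eta mul0r oppr0 big1// => k _.
  have lpk : lam k * p k = 0 by apply: (psumr_eq0P _ PE).
  by rewrite mulrN mulrA lpk mul0r oppr0.
apply: (@le_trans _ _ (\sum_k (- (lam k * p k * ln P) +
    (lam k * P - lam k * p k)))).
  apply: ler_sum => k _.
  have : eta (p k) <= - (p k * ln P) + P - p k.
    by apply: eta_gibbs => // PE; rewrite PE eqxx in PN.
  move=> /(ler_wpM2l (l0 k)) h; apply: le_trans h _.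
  by rewrite !mulrDr !mulrN mulrA addrA.
rewrite big_split/= sumrN -mulr_suml -/P big_split/= sumrN -mulr_suml l1 -/P.
by rewrite mul1r subrr addr0.
Qed.

(** Since [G] sees [t] only through the finite label [h t], the integral is a finite average, and
    the law of [G] is the same average of the fiber laws; Jensen's inequality applies label by
    label. *)
Lemma lent_fiber_le d1 d2 (S : measurableType d1) (X : measurableType d2)
    (R : realType) (m : probability S R) (mu : probability X R)
    (K L : finType) (h : S -> K) (G : S * X -> L) :
  lmeas h -> lmeas G -> (forall t s x, h t = h s -> G (t, x) = G (s, x)) ->
  (\int[m]_t (lent mu (fun x => G (t, x)))%:E <= (lent (m \x mu)%E G)%:E)%E.
Proof.
move=> mh mG hG; have [r hr] := fiber_section h point.
have mGt t : lmeas (fun x => G (t, x)).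
  move=> A; rewrite (_ : _ @^-1` _ = xsection (G @^-1` A) t).
    by apply: measurable_xsection; exact: mG.
  by apply/seteqP; split => x; rewrite /xsection/= inE.
have Gr t x : G (t, x) = G (r (h t), x) by apply: hG; rewrite hr.
pose p k l := lprob mu (fun x => G (r k, x)) l.
have pE t : (fun x => G (t, x)) = (fun x => G (r (h t), x)).
  by apply/funext => x; exact: Gr.
rewrite (eq_integral (fun t => (\sum_l eta (p (h t) l))%:E)); last first.
  by move=> t _; rewrite pE.
rewrite (integral_label m (F := fun k => \sum_l eta (p k l)) mh); last first.
  by move=> k; exact: (lent_ge0 mu (mGt (r k))).
rewrite lee_fin; under eq_bigr do rewrite mulr_suml.
rewrite exchange_big/=; apply: ler_sum => l _.
have -> : lprob (m \x mu)%E G l = \sum_k lprob m h k * p k l.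
  rewrite {1}/lprob /= /product_measure1.
  rewrite (eq_integral (fun t => (p (h t) l)%:E)).
    rewrite (integral_label m (F := fun k => p k l) mh) => [/=|k]; last first.
      exact: lprob_ge0.
    by apply: eq_bigr => k _; rewrite mulrC.
  move=> t _ /=; rewrite /p /lprob -pE fineK; last exact/fin_num_measure/mGt.
  by congr (mu _); apply/seteqP; split => x; rewrite /xsection/= inE.
apply: le_trans (eta_jensen _ _ _).
- by apply: ler_sum => k _; rewrite mulrC.
- by move=> k; exact: lprob_ge0.
- exact: lprob_sum1.
- by move=> k; exact: lprob_ge0.
Qed.

Lemma le_limn_esup_near (R : realType) (u v : nat -> \bar R) :
  (\forall n \near \oo, (u n <= v n)%E) -> (limn_esup u <= limn_esup v)%E.
Proof.
move=> [N _ uv]; rewrite !limn_esup_lim; apply: lee_lim.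
- exact: is_cvg_esups.
- exact: is_cvg_esups.
- exists N => // n /= Nn; apply: ge_ereal_sup => _ [k /= nk <-].
  apply: le_trans (uv k (leq_trans Nn nk)) _.
  by apply: ereal_sup_ubound; exists k.
Qed.

Lemma le_limn_esup_cvg (R : realType) (u : nat -> \bar R) (v : nat -> R) :
  cvgn v -> (\forall n \near \oo, (u n <= (v n)%:E)%E) ->
  (limn_esup u <= limn (fun n => (v n)%:E))%E.
Proof.
move=> cv uv; have cve : cvgn (fun n => (v n)%:E).
  by apply/cvg_ex; exists (limn v)%:E; apply: cvg_EFin => //; exact: nearW.
by rewrite -(is_cvg_limn_esupE cve); exact: le_limn_esup_near.
Qed.

Lemma cvg_limn_le_esup (R : realType) (v u : nat -> R) (e : R) :
  cvgn v -> (\forall n \near \oo, v n <= u n + e) ->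
  (limn (fun n => (v n)%:E) <= limn_esup (fun n => (u n)%:E) + e%:E)%E.
Proof.
move=> cv uv.
have lE (w : nat -> R) : cvgn w -> limn (fun n => (w n)%:E) = (limn w)%:E.
  move=> cw; apply: cvg_lim => //; apply: cvg_EFin => //; exact: nearW.
have cve : cvgn (fun n => v n - e) by apply: is_cvgB => //; exact: is_cvg_cst.
rewrite -leeBlDr// lE// -EFinB.
have -> : limn v - e = limn (fun n => v n - e).
  by rewrite limB//; [rewrite lim_cst|exact: is_cvg_cst].
rewrite -lE//; have cvE : cvgn (fun n => (v n - e)%:E).
  by apply/cvg_ex; exists (limn (fun n => v n - e))%:E; apply: cvg_EFin => //;
    exact: nearW.
rewrite -(is_cvg_limn_esupE cvE); apply: le_limn_esup_near.
by apply: filterS uv => n; rewrite lee_fin lerBlDr.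
Qed.

Lemma ln_affine_sublinear (R : realType) (C : nat) (e : R) : 0 < e ->
  \forall n \near \oo, n%:R^-1 * ln (n * C).+1%:R <= e.
Proof.
(* The tangent bound [ln y <= q * y - 1 - ln q] has a slope chosen so that
   [n * C * q <= n * (e / 2)]; the constant [A] is absorbed for large [n]. *)
move=> e0; pose q : R := e / 2 / C.+1%:R.
have C1 : (0 : R) < C.+1%:R by rewrite ltr0n.
have q0 : 0 < q by rewrite !divr_gt0.
pose A := `|q - 1 - ln q|.
pose N := (Num.trunc (A / (e / 2))).+1.
have NC : A / (e / 2) < N%:R by exact: truncnS_gt.
near=> n.
have n0 : (0 < n)%N by near: n; exact: nbhs_infty_gt.
have nR : (0 : R) < n%:R by rewrite ltr0n.
have nN : (N <= n)%N by near: n; exact: nbhs_infty_ge.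
rewrite mulrC ler_pdivrMr//.
have y0 : (0 : R) < (n * C).+1%:R by rewrite ltr0n.
have h1 : ln ((n * C).+1%:R) + ln q <= (n * C).+1%:R * q - 1.
  rewrite -lnM ?posrE//.
  rewrite -[X in ln X](subrK 1) [X in ln X]addrC; apply: le_ln1Dx.
  by have := mulr_gt0 y0 q0; lra.
have h2 : (n * C).+1%:R * q <= n%:R * (e / 2) + q.
  rewrite -natr1 mulrDl mul1r lerD2r natrM -mulrA ler_wpM2l// /q.
  by rewrite mulrA ler_pdivrMr// mulrC ler_wpM2l ?ler_nat//; lra.
have h3 : A <= n%:R * (e / 2).
  rewrite -ler_pdivrMr; last by lra.
  by rewrite (le_trans (ltW NC))// ler_nat.
have h4 : q - 1 - ln q <= A by exact: ler_norm.
lra.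
Unshelve. all: by end_near. Qed.

Lemma lent_snd d1 d2 (S : measurableType d1) (X : measurableType d2)
    (R : realType) (m : probability S R) (mu : probability X R)
    (L : finType) (g : X -> L) : lmeas g ->
  lent (m \x mu)%E (g \o snd) = lent mu g.
Proof.
move=> mg; apply: eq_bigr => l _; congr eta; rewrite /lprob; congr fine.
rewrite (_ : (g \o snd) @^-1` [set l] = setT `*` (g @^-1` [set l])); last first.
  by apply/seteqP; split => p //= [].
have ml : measurable (g @^-1` [set l]) by exact: mg.
rewrite /= product_measure1E//.
by rewrite -[RHS]mul1e; congr (_ * _)%E; exact: probability_setT.
Qed.

Section entropies.
Context (R : realType) (X : pmetricType R).
Variables (T : int * int -> X -> X) (mu : probability (borel X) R) (beta : R).
Hypotheses (actT : Z2_action T) (invT : Z2_invariant T mu).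

Local Notation Om := (torus R).
Local Notation m := (@torus_leb R).
Local Notation Th := (skew_product T beta).
Local Notation mt := (skew_measure mu).

Let mpT w := measure_preserving_action actT invT w.
Let mpTh : measure_preserving mt Th :=
  measure_preserving_skew_product beta actT invT.

(** * Fiber entropy as a subadditive limit *)

Section label.
Variables (L : finType) (lab : borel X -> L).
Hypothesis mlab : lmeas lab.

Let mlabT w : lmeas (lab \o (T w : borel X -> borel X)) :=
  lmeas_preserving (mpT w) mlab.

Definition fiber_label n (t : Om) :=
  jtup (iota 0 n) (fun i => lab \o cocycle T beta i t).

Definition fiber_lent n (t : Om) : R := lent mu (fiber_label n t).

(** The jumps of the functions [floor (t + i * beta)] for [i < n]; between them the fiber label does
    not depend on [t]. *)
Definition rot_cuts n := [seq cut (i%:R * beta) | i <- iota 0 n].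

Lemma lmeas_fiber_label n t : lmeas (fiber_label n t).
Proof.
by apply: lmeas_jtup => i _; rewrite (cocycleE _ actT); exact: mlabT.
Qed.

Lemma fiber_label_cutidx n t s :
  cutidx (rot_cuts n) t = cutidx (rot_cuts n) s ->
  fiber_label n t = fiber_label n s.
Proof.
move=> /cutidx_eq ts; apply/funext => x; apply/val_inj/eq_in_map => i /= iin.
rewrite !(cocycleE _ actT) (@floor_torus_eq _ t s)//.
by apply: ts; apply/mapP; exists i.
Qed.

Lemma measurable_fiber_lent n :
  measurable_fun setT (fun t => (fiber_lent n t)%:E).
Proof.
have [|phi e] := @factorP _ _ _ (cutidx (rot_cuts n)) (fiber_lent n) point.
  by move=> t s /fiber_label_cutidx ts; rewrite /fiber_lent ts.
rewrite (_ : (fun _ => _) = fun t => (phi (cutidx (rot_cuts n) t))%:E).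
  move=> _ B _; rewrite setTI.
  exact: (@lmeas_cutidx R (rot_cuts n) [set l | B (phi l)%:E]).
by apply/funext => t; rewrite e.
Qed.

Lemma fiber_lent_ge0 n t : 0 <= fiber_lent n t.
Proof. by apply: lent_ge0; exact: lmeas_fiber_label. Qed.

Lemma fiber_lent_le n t :
  fiber_lent n t <= ln #|{: (size (iota 0 n)).-tuple L}|%:R.
Proof. by apply: lent_card; exact: lmeas_fiber_label. Qed.

Definition fiber_int n : R := fine (\int[m]_t (fiber_lent n t)%:E).

(** The integral is finite because the fiber entropies are bounded, uniformly in [t], by the
    logarithm of the number of labels. *)
Lemma fiber_intE n : (\int[m]_t (fiber_lent n t)%:E = (fiber_int n)%:E)%E.
Proof.
rewrite /fiber_int fineK// ge0_fin_numE; last first.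
  by apply: integral_ge0 => t _; rewrite lee_fin fiber_lent_ge0.
pose M := ln #|{: (size (iota 0 n)).-tuple L}|%:R : R.
apply: (@le_lt_trans _ _ (\int[m]_t (cst M%:E t))%E).
  apply: ge0_le_integral => //.
  - by move=> t _; rewrite lee_fin fiber_lent_ge0.
  - exact: measurable_fiber_lent.
  - by move=> t _; rewrite lee_fin fiber_lent_le.
by rewrite (integral_cst_probability m) ltry.
Qed.

Lemma fiber_int_ge0 n : 0 <= fiber_int n.
Proof.
by apply: fine_ge0; apply: integral_ge0 => t _; rewrite lee_fin fiber_lent_ge0.
Qed.

Lemma cocycle_add i k t x :
  cocycle T beta (i + k) t x =
  cocycle T beta i (iter k (rot beta) t) (cocycle T beta k t x).
Proof. by elim: i => [//|i IH] /=; rewrite IH -iterD. Qed.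

(** By the cocycle identity, the labels after time [k] are those of the fiber over the rotated
    point, pulled back by a map preserving [mu]. *)
Lemma fiber_lent_add k n t :
  fiber_lent (k + n) t <= fiber_lent k t + fiber_lent n (iter k (rot beta) t).
Proof.
have mk := lmeas_fiber_label (n := k) t.
have mn := lmeas_fiber_label (n := n) (iter k (rot beta) t).
have mpc : measure_preserving mu (cocycle T beta k t).
  by rewrite (cocycleE _ actT); exact: mpT.
have mnc := lmeas_preserving mpc mn.
rewrite /fiber_lent -[X in _ <= _ + X](lent_preserving mpc mn).
apply: le_trans (lent_pair mu mk mnc).
apply: lent_mono; first exact: lmeas_pair mk mnc.
move=> x y e; have /jtup_eqP e1 := congr1 fst e.
have /jtup_eqP e2 := congr1 snd e.
apply/jtup_eqP => i; rewrite mem_iota add0n => /= ikn.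
have [ik|ki] := ltnP i k; first by apply: e1; rewrite mem_iota.
have /= := e2 (i - k)%N; rewrite -!cocycle_add subnK//; apply.
by rewrite mem_iota add0n/= ltn_subLR.
Qed.

Lemma fiber_int_add k n : fiber_int (k + n) <= fiber_int k + fiber_int n.
Proof.
rewrite -lee_fin EFinD -!fiber_intE.
have mpk := measure_preserving_iter k (measure_preserving_rot beta).
(* Rotation invariance removes the shift of the base point. *)
have e : (\int[m]_t (fiber_lent n (iter k (rot beta) t))%:E =
          \int[m]_t (fiber_lent n t)%:E)%E.
  apply: (integral_preserving (g := fun t => (fiber_lent n t)%:E) mpk).
    exact: measurable_fiber_lent.
  by move=> t; rewrite lee_fin fiber_lent_ge0.
have mnk : measurable_fun setT
    (fun t => (fiber_lent n (iter k (rot beta) t))%:E).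
  apply: (measurableT_comp (measurable_fiber_lent n)).
  exact: measurable_preserving mpk.
rewrite -e -ge0_integralD//.
- apply: ge0_le_integral => //.
  + by move=> t _; rewrite lee_fin fiber_lent_ge0.
  + exact: measurable_fiber_lent.
  + by apply: emeasurable_funD => //; exact: measurable_fiber_lent.
  + by move=> t _; rewrite -EFinD lee_fin fiber_lent_add.
- by move=> t _; rewrite lee_fin fiber_lent_ge0.
- exact: measurable_fiber_lent.
- by move=> t _; rewrite lee_fin fiber_lent_ge0.
Qed.

Lemma fiber_int_cvg : cvgn (fun n => n%:R^-1 * fiber_int n).
Proof. exact: fekete fiber_int_ge0 fiber_int_add. Qed.

Lemma fiber_entropy_partE : fiber_entropy_part T mu beta (fibers lab) =
  limn (fun n => (n%:R^-1 * fiber_int n)%:E).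
Proof.
rewrite /fiber_entropy_part; congr (limn _); apply/funext => n.
rewrite EFinM -fiber_intE -ge0_integralZl_EFin//.
- apply: eq_integral => t _; rewrite -EFinM (entropy_join _ _ _ (set_iota n))//.
- by move=> t _; rewrite lee_fin fiber_lent_ge0.
- exact: measurable_fiber_lent.
Qed.

(** On the fiber over [t], the join of [lab \o snd] along the skew product is the fiber label, and
    it depends on [t] only through [cutidx]; [lent_fiber_le] compares the two at each [n]. *)
Lemma fiber_le_ks : (fiber_entropy_part T mu beta (fibers lab) <=
  ks_entropy_part mt Th (fibers (lab \o snd)))%E.
Proof.
rewrite fiber_entropy_partE /ks_entropy_part.
have msnd : lmeas (lab \o snd : Om * borel X -> L).
  move=> A; rewrite -[X in measurable X]setTI comp_preimage.
  by apply: measurable_snd => //; exact: mlab.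
under [X in (_ <= limn X)%E]eq_fun do rewrite (entropy_join _ _ _ (set_iota _)).
have cks := lent_iter_cvg mpTh msnd.
have cvE (u : nat -> R) : cvgn u -> cvgn (fun n => (u n)%:E).
  move=> cu; apply/cvg_ex; exists (limn u)%:E; apply: cvg_EFin => //.
  exact: nearW.
apply: lee_lim; [exact: cvE fiber_int_cvg|exact: cvE cks|].
apply: nearW => n; rewrite lee_fin ler_wpM2l ?invr_ge0//.
rewrite -lee_fin -fiber_intE.
have GE p : jtup (iota 0 n) (fun i => lab \o snd \o iter i Th) p =
    fiber_label n p.1 p.2.
  by apply/val_inj/eq_in_map => i _ /=; rewrite iter_skew_product.
have mG : lmeas (jtup (iota 0 n) (fun i => lab \o snd \o iter i Th)).
  apply: lmeas_jtup => i _.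
  exact: (lmeas_preserving (measure_preserving_iter i mpTh) msnd).
have hG (t s : Om) (x : borel X) :
    cutidx (rot_cuts n) t = cutidx (rot_cuts n) s ->
    jtup (iota 0 n) (fun i => lab \o snd \o iter i Th) (t, x) =
    jtup (iota 0 n) (fun i => lab \o snd \o iter i Th) (s, x).
  by move=> /fiber_label_cutidx ts; rewrite !GE /= ts.
have h : (_ <= (lent mt _)%:E)%E :=
  lent_fiber_le m mu (@lmeas_cutidx R (rot_cuts n)) mG hG.
apply: le_trans h.
rewrite le_eqVlt; apply/orP; left; apply/eqP; apply: eq_integral => t _.
by rewrite /fiber_lent; congr (lent _ _)%:E; apply/funext => x; rewrite GE.
Qed.

End label.

Lemma finite_strip_upto b N : finite_set (strip_upto beta b N).
Proof.
(* [K] exceeds the height of every point of the truncated strip, so adding it to the second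
   coordinate gives a natural number. *)
pose K := (Num.trunc (`|beta| * N%:R + `|b|)).+1.
have KC : `|beta| * N%:R + `|b| < K%:R by exact: truncnS_gt.
apply: (@sub_finite_set _ _ ((fun p : nat * nat => (p.1%:Z, p.2%:Z - K%:Z)) @`
  (`I_N `*` `I_(K + K)))); last first.
  by apply: finite_image; apply: finite_setX; exact: finite_II.
move=> [i j] [/= /andP[jl ju] /andP[i0 iN]].
have iE : i = `|i|%N%:Z by rewrite gez0_abs.
have iNn : (`|i| < N)%N by lia.
have iR : `|beta * i%:~R| <= `|beta| * N%:R.
  by rewrite normrM ler_wpM2l// iE -pmulrn ger0_norm// ler_nat ltnW.
have jb : `|j%:~R| <= `|beta| * N%:R + `|b| :> R.
  rewrite ler_norml; move: iR; rewrite ler_norml => /andP[? ?].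
  have := ler_norm b; have := ler_norm (- b); rewrite normrN.
  by move=> *; apply/andP; split; lra.
have jK : (`|j| < K%:Z)%R.
  by rewrite -(ltr_int R) intr_norm (le_lt_trans jb).
exists (`|i|%N, absz (j + K%:Z)); first by split => /=; lia.
by congr (_, _) => /=; lia.
Qed.

(** * Covering the strip by vertical translates of one path *)

Section directional.
Variables (L : finType) (lab : borel X -> L).
Hypothesis mlab : lmeas lab.

Let mlabT w : lmeas (lab \o (T w : borel X -> borel X)) :=
  lmeas_preserving (mpT w) mlab.

Definition vertical_label (K : nat) :=
  jtup [seq i%:Z - K%:Z | i <- iota 0 (K + K).+1]
    (fun k : int => lab \o (T (0, k) : borel X -> borel X)).

Lemma lmeas_vertical_label K : lmeas (vertical_label K).
Proof. by apply: lmeas_jtup => k _; exact: mlabT. Qed.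

Lemma dir_le_fiber (b : R) : exists K,
  (limn_esup (fun N => (N%:R^-1 *
      entropy mu (partition_join (strip_upto beta b N)
        (fun w => preimage_partition (T w : borel X -> borel X)
                    (fibers lab))))%:E) <=
  fiber_entropy_part T mu beta (fibers (vertical_label K)))%E.
Proof.
(* A point [(i, j)] of the strip has [j] within [b] of [i * beta], and the path over [t] is at
   height within 1 of it; hence the vertical gap is less than [K]. *)
pose K := (Num.trunc (`|b| + 1)).+1; exists K.
have KC : `|b| + 1 < K%:R by exact: truncnS_gt.
have mv := @lmeas_vertical_label K.
rewrite (fiber_entropy_partE mv).
apply: (le_limn_esup_cvg (fiber_int_cvg mv)); apply: nearW => N.
rewrite lee_fin ler_wpM2l ?invr_ge0//.
have /finite_seqP[s sE] := finite_strip_upto b N.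
rewrite (entropy_join _ _ _ sE) -lee_fin -fiber_intE//.
(* The strip entropy does not involve [t], so it equals its integral and can be compared with the
   fiber entropy at every [t]. *)
set c := lent _ _; apply: (@le_trans _ _ (\int[m]_t (cst c%:E t))%E).
  by rewrite (integral_cst_probability m).
apply: ge0_le_integral => //.
- by move=> t _; rewrite lee_fin lent_ge0//; apply: lmeas_jtup.
- exact: measurable_fiber_lent.
move=> t _; rewrite lee_fin; apply: lent_mono; first exact: lmeas_fiber_label.
move=> x y /jtup_eqP xy; apply/jtup_eqP => -[i j] ws.
have : strip_upto beta b N (i, j) by rewrite sE.
move=> [/= /andP[jl ju] /andP[i0 iN]].
have iE : i = `|i|%N%:Z by rewrite gez0_abs.
have iin : `|i|%N \in iota 0 N by rewrite mem_iota; lia.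
set f := Num.floor (torus_val t + (absz i)%:R * beta).
have iR : (absz i)%:R = i%:~R :> R by rewrite [in RHS]iE -pmulrn.
have /andP[fl fu] := floor_itv (torus_val t + (absz i)%:R * beta).
rewrite -/f iR in fl fu; rewrite intrD in fu.
have /andP[t0 t1] := torus_val_itv t.
have := ler_norm b => bb.
have jfu : j - f < K%:Z by rewrite -(ltr_int R) intrB -pmulrn; lra.
have jfl : - K%:Z < j - f by rewrite -(ltr_int R) intrB intrN -pmulrn; lra.
have jin : j - f \in [seq i%:Z - K%:Z | i <- iota 0 (K + K).+1].
  apply/mapP; exists (absz ((j - f) + K%:Z)); last by clear -jfl; lia.
  by rewrite mem_iota; clear -jfl jfu; lia.
have /jtup_eqP/(_ _ jin) : vertical_label K (cocycle T beta (absz i) t x) =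
  vertical_label K (cocycle T beta (absz i) t y) := xy _ iin.
rewrite (cocycleE _ actT) /comp !(action_add actT) -/f.
(* The strip point is reached by the path at time [i], followed by a vertical translate recorded in
   [vertical_label K]. *)
suff -> : (0, j - f) + ((absz i)%:Z, f) = (i, j) by [].
by rewrite -[LHS]/(0 + (absz i)%:Z, j - f + f) add0r subrK -iE.
Qed.
End directional.

(** The first [n] labels of an orbit are recovered from the interval of [t], the strip label of [x]
    and the errors along the orbit. After division by [n], the first and the last cost at most
    [e / 2] each. *)
Lemma ks_le_dir (L : finType) (c : Om * borel X -> L) : lmeas c ->
  (ks_entropy_part mt Th (fibers c) <= dir_entropy T mu beta)%E.
Proof.
move=> mc; apply/lee_addgt0Pr => e e0.
have e20 : 0 < e / 2 by lra.
have [QQ [BB [M [err [mBB merr lerr cdet]]]]] := approximate_label mu mc e20.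
pose lab : borel X -> (size BB).-tuple bool := jtup BB (fun B x => `[<B x>]).
have mlab : lmeas lab.
  by apply: lmeas_jtup => B /mBB; exact: lmeas_asbool.
apply: (@le_trans _ _ (limn_esup (fun N => (N%:R^-1 *
      entropy mu (partition_join (strip_upto beta 1 N)
        (fun w => preimage_partition (T w : borel X -> borel X)
                    (fibers lab))))%:E) + e%:E)%E); last first.
  apply: leeD2r.
  apply: (@le_trans _ _ (dir_entropy_part T mu beta (fibers lab))); last first.
    apply: ereal_sup_ubound; exists (fibers lab) => //.
    exact: finite_partition_fibers.
  by apply: ereal_sup_ubound; exists 1 => //=.
rewrite /ks_entropy_part.
under [X in (limn X <= _)%E]eq_fun do rewrite (entropy_join _ _ _ (set_iota _)).
apply: (cvg_limn_le_esup (lent_iter_cvg mpTh mc)); near=> n.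
have n0 : (0 < n)%N by near: n; exact: nbhs_infty_gt.
have nR : (0 : R) < n%:R by rewrite ltr0n.
have lnn : n%:R^-1 * ln (n * (size QQ).+1).+1%:R <= e / 2.
  by near: n; exact: ln_affine_sublinear.
have /finite_seqP[s sE] := finite_strip_upto 1 n.
rewrite (entropy_join _ _ _ sE).
(* The cuts for [q = 0] fix the lattice path; adding those for [q] in [QQ] fixes how each rotated
   point compares with [q], by [le_iter_rot]. *)
pose P := [seq cut (i%:R * beta - q) | i <- iota 0 n, q <- 0 :: QQ].
have sP : size P = (n * (size QQ).+1)%N by rewrite size_allpairs size_iota.
pose a (p : Om * borel X) := cutidx P p.1.
pose S := jtup s (fun w => lab \o (T w : borel X -> borel X)).
pose ee := jtup (iota 0 n) (fun i => err \o iter i Th).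
have mS : lmeas S.
  by apply: lmeas_jtup => w _; exact: lmeas_preserving (mpT w) mlab.
have ma : lmeas a.
  move=> A; rewrite (_ : a @^-1` A = fst @^-1` (cutidx P @^-1` A))//.
  rewrite -[X in measurable X]setTI.
  by apply: measurable_fst => //; exact: lmeas_cutidx.
have mS2 : lmeas (S \o snd : Om * borel X -> _).
  move=> A; rewrite -[X in measurable X]setTI comp_preimage.
  by apply: measurable_snd => //; exact: mS.
have mi i := measure_preserving_iter i mpTh.
have mee : lmeas ee.
  by apply: lmeas_jtup => i _; exact: lmeas_preserving (mi i) merr.
have lee : lent mt ee <= n%:R * lent mt err.
  apply: le_trans (lent_jtup mt _) _ => [i _|].
    exact: lmeas_preserving (mi i) merr.
  under eq_bigr do rewrite (lent_preserving (mi _) merr).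
  by rewrite big_const_seq count_predT size_iota iter_addr addr0 mulr_natl.
have la : lent mt a <= ln (n * (size QQ).+1).+1%:R.
  by apply: le_trans (lent_card mt ma) _; rewrite card_ord sP.
have lS : lent mt (S \o snd) = lent mu S := lent_snd m mu mS.
have mSee := lmeas_pair mS2 mee.
have h : lent mt (jtup (iota 0 n) (fun i => c \o iter i Th)) <=
    ln (n * (size QQ).+1).+1%:R + (lent mu S + n%:R * lent mt err).
  apply: (@le_trans _ _ (lent mt (fun p => (a p, ((S \o snd) p, ee p))))).
    apply: lent_mono; first exact: lmeas_pair ma mSee.
    move=> p p' /= epp; have /cutidx_eq ea := congr1 fst epp.
    have /jtup_eqP eS := congr1 (fst \o snd) epp.
    have /jtup_eqP eE := congr1 (snd \o snd) epp.
    apply/jtup_eqP => i iin.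
    have fl q : q \in 0 :: QQ ->
        Num.floor (torus_val p.1 + (i%:R * beta - q)) =
        Num.floor (torus_val p'.1 + (i%:R * beta - q)).
      by move=> qin; apply: floor_torus_eq; apply: ea; apply: allpairs_f.
    have fl0 : Num.floor (torus_val p.1 + i%:R * beta) =
               Num.floor (torus_val p'.1 + i%:R * beta).
      by have := fl 0 (mem_head _ _); rewrite subr0.
    apply: cdet.
    - move=> q qQ; rewrite !iter_skew_product /=; apply: le_iter_rot => //.
      by apply: fl; rewrite inE qQ orbT.
    (* With the same path over both base points, the label at time [i] is one coordinate of the
       strip label. *)
    - have elab : lab (iter i Th p).2 = lab (iter i Th p').2.
        rewrite !iter_skew_product /= !(cocycleE _ actT) -fl0.
        apply: eS; have : strip_upto beta 1 n
            (i%:Z, Num.floor (torus_val p.1 + i%:R * beta)); last by rewrite sE.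
        by apply: floor_in_strip; rewrite mem_iota in iin.
      by move: elab => /jtup_eqP.
    - exact: eE.
  apply: le_trans (lent_pair mt ma mSee) _; rewrite lerD//.
  by apply: le_trans (lent_pair mt mS2 mee) _; rewrite lS lerD.
apply: le_trans (ler_wpM2l _ h) _; first by rewrite invr_ge0 ltW.
rewrite !mulrDr mulKf ?gt_eqF//; lra.
Unshelve. all: by end_near. Qed.

End entropies.

Theorem theorem3p1 (R : realType) (X : pmetricType R)
    (T : int * int -> X -> X) (mu : probability (borel X) R) (beta : R) :
  compact [set: X] -> Z2_action T -> Z2_invariant T mu -> irrational beta ->
  dir_entropy T mu beta = ks_entropy (skew_measure mu) (skew_product T beta) /\
  ks_entropy (skew_measure mu) (skew_product T beta) = fiber_entropy T mu beta.
Proof.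
move=> _ actT invT _.
have fk : (fiber_entropy T mu beta <=
           ks_entropy (skew_measure mu) (skew_product T beta))%E.
  apply: ge_ereal_sup => _ [a /finite_partitionP[L [lab [mlab ->]]] <-].
  apply: le_trans (fiber_le_ks beta actT invT mlab) _.
  apply: ereal_sup_ubound; exists (fibers (lab \o snd)) => //.
  apply: finite_partition_fibers => A; rewrite -[X in measurable X]setTI.
  by rewrite comp_preimage; apply: measurable_snd => //; exact: mlab.
have kd : (ks_entropy (skew_measure mu) (skew_product T beta) <=
           dir_entropy T mu beta)%E.
  apply: ge_ereal_sup => _ [a /finite_partitionP[L [c [mc ->]]] <-].
  exact: ks_le_dir.
have df : (dir_entropy T mu beta <= fiber_entropy T mu beta)%E.
  apply: ge_ereal_sup => _ [a /finite_partitionP[L [lab [mlab ->]]] <-].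
  apply: ge_ereal_sup => _ [b _ <-].
  have [K] := dir_le_fiber beta actT invT mlab b; move/le_trans; apply.
  apply: ereal_sup_ubound; exists (fibers (vertical_label T lab K)) => //.
  apply: finite_partition_fibers.
  exact: (lmeas_vertical_label actT invT mlab).
by split; apply/le_anti/andP; split=> //;
  [exact: le_trans fk|exact: le_trans df].
Qed.
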